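(* Let $0<\varepsilon<\frac1{85}$. Let $G_0$ be a graph on $n$ vertices, and let $\Pi=(V_1,\dots,V_k)$ be a partition of its vertices satisfying $\left||V_i|-|V_j|\right|\le1$ for all $i,j\in\{1,\dots,k\}$, where $k\ge\frac2{\varepsilon^2}$ is a constant, and $n$ is large enough. Let $S=S(G_0,\Pi,\varepsilon)$ be the corresponding $\varepsilon$-graph. Then for $\delta=48\varepsilon$ and any absolute constant $C_1>2.1$ we have the following. (1) If $S$ contains a path of an odd length $b$, $1\le b<k$, then $G_0$ contains cycles of all even lengths in $\left[\frac{C_1}{\log(1/\varepsilon)}\log n,\ (1-\delta)an\right]$, where $a=\frac{b+1}k$. (2) If $S$ contains a cycle of an odd length $b$, $3\le b<k$, then $G_0$ contains cycles of all odd lengths in $\left[\frac{(b-1)C_1}{2\log(1/\varepsilon)}\log n,\ (1-\delta)an\right]$, where $a=\frac bk$.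
   Context: Graphs are finite and simple; $\log$ is the natural logarithm; the length of a path or cycle is its number of edges. ''$n$ large enough'' means larger than a constant that may depend on $\varepsilon$, $k$ and $C_1$. $\varepsilon$-property: let $G$ be a graph and $V_1,V_2\subseteq V(G)$ disjoint with $|V_1|,|V_2|\in\{\lfloor m\rfloor,\lceil m\rceil\}$ for some positive number $m$. The pair $(V_1,V_2)$ satisfies the $\varepsilon$-property in $G$ if for all $U_1\subseteq V_1$ and $U_2\subseteq V_2$ with $|U_1|,|U_2|\ge\varepsilon m$, $G$ contains at least one edge between $U_1$ and $U_2$. $\varepsilon$-graph: for a graph $G_0$ on $n$ vertices and a partition $\Pi=(V_1,\dots,V_k)$ of its vertex set with $||V_i|-|V_j||\le1$ for all $i,j$, the $\varepsilon$-graph $S(G_0,\Pi,\varepsilon)$ is the graph with vertex set $\{1,\dots,k\}$ in which $\{i,j\}$ is an edge if the pair $(V_i,V_j)$ satisfies the $\varepsilon$-property in $G_0$ (with $m=n/k$). *)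

(* Defs.v *)
From mathcomp Require Import all_boot all_order all_algebra.
From mathcomp Require Import boolp reals exp.

Set Implicit Arguments.
Unset Strict Implicit.
Unset Printing Implicit Defensive.

Import Order.TTheory GRing.Theory Num.Theory.

Local Open Scope ring_scope.

Record sgraph (T : finType) := SGraph {
  adj :> rel T;
  adj_sym : symmetric adj;
  adj_irrefl : irreflexive adj
}.

Definition has_path (T : finType) (G : sgraph T) (b : nat) : Prop :=
  exists (x : T) (p : seq T), [/\ path G x p, uniq (x :: p) & size p = b].

(* [ucycle] also accepts sequences of length at most 2. *)
Definition has_cycle (T : finType) (G : sgraph T) (b : nat) : Prop :=
  (3 <= b)%N /\ exists c : seq T, ucycle G c /\ size c = b.

Definition eps_property (R : realType) (T : finType) (G : sgraph T)
    (eps m : R) (V1 V2 : {set T}) : Prop :=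
  [/\ [disjoint V1 & V2],
      #|V1|%:Z \in [:: Num.floor m; Num.ceil m],
      #|V2|%:Z \in [:: Num.floor m; Num.ceil m] &
      forall U1 U2 : {set T}, U1 \subset V1 -> U2 \subset V2 ->
        eps * m <= #|U1|%:R -> eps * m <= #|U2|%:R ->
        exists x y : T, [/\ x \in U1, y \in U2 & G x y]].

(* Injectivity of [V] makes the parts pairwise disjoint, since [partition]
   only sees the set of parts. *)
Definition balanced_partition (T : finType) (k : nat) (V : 'I_k -> {set T}) :
    Prop :=
  [/\ injective V,
      partition [set V i | i : 'I_k] [set: T] &
      forall i j : 'I_k, `|#|V i|%:Z - #|V j|%:Z| <= 1].

Section EpsGraph.
Context (R : realType) (T : finType) (G : sgraph T) (k : nat).
Context (V : 'I_k -> {set T}) (eps : R).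

Definition eps_adj : rel 'I_k := fun i j =>
  (i != j) && `[< eps_property G eps (#|T|%:R / k%:R) (V i) (V j) >].

Lemma eps_property_sym (m : R) (V1 V2 : {set T}) :
  eps_property G eps m V1 V2 -> eps_property G eps m V2 V1.
Proof.
case=> dV s1 s2 h; split=> //; first by rewrite disjoint_sym.
move=> U1 U2 sU1 sU2 l1 l2; have [x [y [xU yU xy]]] := h _ _ sU2 sU1 l2 l1.
by exists y, x; split=> //; rewrite adj_sym.
Qed.

Lemma eps_adj_sym : symmetric eps_adj.
Proof.
move=> i j; rewrite /eps_adj eq_sym; congr (_ && _).
by apply/asboolP/asboolP; apply: eps_property_sym.
Qed.

Lemma eps_adj_irrefl : irreflexive eps_adj.
Proof. by move=> i; rewrite /eps_adj eqxx. Qed.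

Definition eps_graph : sgraph 'I_k := SGraph eps_adj_sym eps_adj_irrefl.

End EpsGraph.

(* Main.v *)
(* The core is a connection of exact length. Deleting a maximal non-expanding
   pair of sets from a pair with the eps-property leaves [W0], [W1] in which all
   small sets expand by a factor [D + 2] across the pair; there the
   Friedman-Pippenger argument embeds, from any [x] in [W0] and [y] in [W1], a
   path of prescribed even length at [y] followed by two disjoint trees of
   branching at most [D] and prescribed depth [j], such that the neighbourhoods
   of their leaf sets must be joined by an edge. This yields [x]-[y] paths of
   every odd length from [2j + 3] up to a small multiple of the number of leaves.

   Short cycles: take [D] about 1/eps and close up with a path of length 1 (for
   even cycles) or with a path once around the odd cycle of the eps-graph. The
   depth is about [ln n / ln D], whence the constant 2.1.

   Long cycles: reserve small pieces of the clusters for [W0], [W1] and for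
   one-vertex-per-cluster return routes, and delete the few vertices without
   such a route. Depth-first search finds almost spanning paths in disjoint
   pairs (or pairs of halves) of clusters; these are linked into one long path,
   every initial segment of which, of suitable parity, closes up through a
   return route and a connection of the exact remaining length. *)

Require Import Defs.
From mathcomp Require Import all_boot all_order all_algebra.
From mathcomp Require Import boolp reals exp.
From mathcomp Require Import zify lra ring.

Set Implicit Arguments.
Unset Strict Implicit.
Unset Printing Implicit Defensive.

Ltac arith :=
  repeat match goal with
  | H : is_true (leq _ _) |- _ => revert H
  | H : @eq ?A _ _ |- _ => unify A nat; revert H
  end;
  repeat match goal with
  | H : ?P |- _ => match type of P with Prop => clear H end
  end;
  intros; lia.

Lemma disjointP (T : finType) (A B : {pred T}) :
  reflect (forall x, x \in A -> x \notin B) [disjoint A & B].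
Proof. by rewrite disjoint_subset; apply: (iffP subsetP) => h x /h; rewrite !inE. Qed.

(** * Tree embedding in expanding graphs *)

Section Neighbourhoods.
Variables (T : finType) (e : rel T).
Implicit Types X Y : {set T}.

Definition nbs (X : {set T}) := [set y | [exists x in X, e x y]].

Lemma nbsP (X : {set T}) y : reflect (exists2 x, x \in X & e x y) (y \in nbs X).
Proof. by rewrite inE; apply: (iffP exists_inP). Qed.

Lemma nbs0 : nbs set0 = set0.
Proof. by apply/setP => y; rewrite in_set0; apply/nbsP => -[x]; rewrite inE. Qed.

Lemma nbsU X Y : nbs (X :|: Y) = nbs X :|: nbs Y.
Proof.
apply/setP => y; rewrite in_setU; apply/nbsP/orP.
  by case=> x; rewrite inE => /orP[xX|xY] xy; [left|right]; apply/nbsP; exists x.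
by case=> /nbsP[x xX xy]; exists x => //; rewrite inE xX ?orbT.
Qed.

Lemma nbsS X Y : X \subset Y -> nbs X \subset nbs Y.
Proof. by move=> sXY; rewrite -(setUidPr sXY) nbsU subsetUl. Qed.

Lemma nbsI X Y : nbs (X :&: Y) \subset nbs X :&: nbs Y.
Proof. by rewrite subsetI !nbsS ?subsetIl ?subsetIr. Qed.

(** The edge condition of the eps-property with an integer threshold [s] in place of [eps * m], and
    with no condition on the sizes of the two sets. *)
Definition joined s (A B : {set T}) := forall X Y : {set T},
  X \subset A -> Y \subset B -> s <= #|X| -> s <= #|Y| ->
  exists x y, [/\ x \in X, y \in Y & e x y].

Lemma joinedS s (A B A' B' : {set T}) :
  A' \subset A -> B' \subset B -> joined s A B -> joined s A' B'.
Proof.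
move=> sA sB j X Y sX sY; apply: j; [exact: subset_trans sA|exact: subset_trans sB].
Qed.

Lemma joined_nbs s (A B X : {set T}) : joined s A B -> X \subset A -> s <= #|X| ->
  #|B :\: nbs X| < s.
Proof.
move=> j sX hX; rewrite ltnNge; apply/negP => hY.
have [x [y [xX]]] := j _ _ sX (subsetDl _ _) hX hY.
by rewrite inE => /andP[/nbsP yN _] xy; apply: yN; exists x.
Qed.

Lemma joined_sym s (A B : {set T}) : symmetric e -> joined s A B -> joined s B A.
Proof.
move=> es j X Y sX sY hX hY; have [x [y [xX yY xy]]] := j _ _ sY sX hY hX.
by exists y, x; split; rewrite // es.
Qed.

End Neighbourhoods.

Section Embedding.
Variables (T : finType) (e : rel T) (R : {set T}) (D b : nat).
Implicit Types (F X Y : {set T}) (d : T -> nat).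

Notation N := (nbs e).

(* [d v] is the number of children still owed to [v]; vertices outside the
   embedded set [F] are owed [D]. *)
Definition extendable F d := [forall X : {set T},
  (X \subset R) && (#|X| <= b) ==> (\sum_(x in X) d x <= #|N X :\: F|)].

Lemma extendableP F d X : extendable F d -> X \subset R -> #|X| <= b ->
  \sum_(x in X) d x <= #|N X :\: F|.
Proof. by move=> /forallP/(_ X)/implyP h s1 s2; apply: h; rewrite s1. Qed.

Hypothesis expand : forall X, X \subset R -> #|X| <= b -> D.+2 * #|X| <= #|N X|.

(* If no candidate works, each of them is adjacent to a critical set, one with
   equality in [extendable]. Expansion makes critical sets small, so they are
   closed under union; adding [v] to the union of all of them contradicts
   [extendable F d]. *)
Lemma extend_vertex F d v : (forall x, d x <= D) -> 0 < b -> 2 * #|F| <= b ->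
  extendable F d -> v \in R -> 0 < d v ->
  exists w, [/\ e v w, w \notin F & extendable (w |: F) (fun x => d x - (x == v))].
Proof.
move=> dD b0 Fb ext vR dv.
pose crit X := [&& X \subset R, #|X| <= #|F|, \sum_(x in X) d x == #|N X :\: F| & v \notin X].
(* Of at least [(D + 2) * #|X|] neighbours at most [D * #|X|] avoid [F], so [2 * #|X| <= #|F|].
   Unions of two such sets thus stay within the bound [b]. *)
have small X : X \subset R -> #|X| <= b -> #|N X :\: F| <= \sum_(x in X) d x -> #|X| <= #|F|.
  move=> sX hX hN.
  have h1 : \sum_(x in X) d x <= D * #|X|.
    by rewrite mulnC -sum_nat_const leq_sum.
  have := expand sX hX; have := subset_leq_card (subsetIr (N X) F).
  have := cardsID F (N X).
  by arith.
have critU X Y : crit X -> crit Y -> crit (X :|: Y).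
  move=> /and4P[sX hX /eqP dX vX] /and4P[sY hY /eqP dY vY].
  have sU : X :|: Y \subset R by rewrite subUset sX.
  have cU : #|X :|: Y| <= b by have := (leq_card_setU X Y).1; arith.
  have le1 := extendableP ext sU cU.
  have sI : X :&: Y \subset R by rewrite subIset ?sX.
  have cI : #|X :&: Y| <= b by have := subset_leq_card (subsetIl X Y); arith.
  have le2 := extendableP ext sI cI.
  (* The sum of [d] is modular and the number of neighbours outside [F] is submodular. Together with
     the lower bounds [le1] and [le2] this forces equality for the union. *)
  have eS : \sum_(x in X :|: Y) d x + \sum_(x in X :&: Y) d x =
     \sum_(x in X) d x + \sum_(x in Y) d x.
    rewrite [\sum_(x in X :|: Y) _](big_setID X) setUK setDUl setDv set0U /=.
    by rewrite [\sum_(x in Y) _](big_setID X) /= (setIC Y) addnAC addnA.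
  have eN : #|N (X :|: Y) :\: F| + #|N (X :&: Y) :\: F| <= #|N X :\: F| + #|N Y :\: F|.
    rewrite nbsU setDUl -(cardsUI (N X :\: F)) leq_add2l subset_leq_card //.
    by apply: subset_trans (setSD F (nbsI e X Y)) _; rewrite setDIl.
  have eqU : \sum_(x in X :|: Y) d x = #|N (X :|: Y) :\: F| by arith.
  apply/and4P; split => //; last by rewrite inE negb_or vX.
    by apply: small; rewrite // eqU.
  by rewrite eqU.
have crit0 : crit set0.
  by rewrite /crit sub0set cards0 /= big_set0 nbs0 set0D cards0 inE.
pose M := \bigcup_(X | crit X) X.
have critM : crit M by apply: (big_ind (fun X => crit X)).
case: (pickP [pred w | [&& e v w, w \notin F & extendable (w |: F) (fun x => d x - (x == v))]]).
  by move=> w /and3P[? ? ?]; exists w.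
move=> none; exfalso.
have NvM : N [set v] :\: F \subset N M.
  apply/subsetP => w /setDP[/nbsP[x /set1P -> vw] wF].
  have := none w; rewrite /= vw wF /= => /negbT; rewrite negb_forall => /existsP[X].
  rewrite negb_imply -ltnNge => /andP[/andP[sX cX] lt].
  have le := extendableP ext sX cX.
  (* If [v] were in [X], the debt of [X] would drop by one, while embedding [w] removes at most one
     neighbour; then [X] could not violate the condition. So [X] avoids [v], keeps its debt, and
     must have been tight before. *)
  have vX : v \notin X.
    apply/negP => vX; move: lt; rewrite (big_setD1 v) //= eqxx.
    have -> : \sum_(i in X :\ v) (d i - (i == v)) = \sum_(i in X :\ v) d i.
      by apply: eq_bigr => i; rewrite !inE => /andP[/negbTE -> _]; rewrite subn0.
    move: le; rewrite (big_setD1 v) //=.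
    have : #|N X :\: F| <= #|N X :\: (w |: F)|.+1.
      rewrite setUC -setDDl (cardsD1 w (N X :\: F)).
      by case: (w \in _); arith.
    by arith.
  have eX : \sum_(i in X) (d i - (i == v)) = \sum_(i in X) d i.
    apply: eq_bigr => i iX; have [ei|] := eqVneq i v; last by rewrite subn0.
    by rewrite ei (negbTE vX) in iX.
  rewrite eX setUC -setDDl in lt.
  have cw := cardsD1 w (N X :\: F).
  have wN : w \in N X :\: F by case: (w \in _) cw => //; arith.
  rewrite wN in cw.
  have crX : crit X.
    apply/and4P; split=> //; last by arith.
    by apply: small => //; arith.
  have sXM : X \subset M by apply: (bigcup_max X).
  apply: (subsetP (nbsS e sXM)).
  by move: wN; rewrite inE => /andP[].
move: critM => /and4P[sM cM /eqP dM vM].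
have sV : v |: M \subset R by rewrite subUset sub1set vR.
have cV : #|v |: M| = #|M|.+1 by rewrite cardsU1 vM.
have cF : #|M| < b by arith.
have := extendableP ext sV; rewrite cV => /(_ cF).
rewrite big_setU1 //= dM nbsU setDUl.
have -> : N [set v] :\: F :|: N M :\: F = N M :\: F.
  apply/setUidPr; apply/subsetP => w wN; rewrite inE (subsetP NvM) // andbT.
  by move: wN; rewrite inE => /andP[].
by arith.
Qed.

Hypothesis edgeR : forall u v, e u v -> v \in R.
Hypothesis b_gt0 : 0 < b.

(** Children are added one by one, each below some vertex of [A] with a positive debt. The
    strengthened induction claim [H] records that the total debt of [A] drops by exactly one each
    time, so such a vertex exists until [q] children are placed. *)
Lemma extend_children F d (A : {set T}) q :
  (forall x, d x <= D) -> extendable F d -> A \subset R ->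
  q <= \sum_(x in A) d x -> 2 * (#|F| + q) <= b ->
  exists (B : {set T}) d', [/\ [disjoint B & F], #|B| = q, B \subset nbs e A &
    [/\ extendable (B :|: F) d', forall x, d' x <= D &
        forall x, x \notin A -> d' x = d x]].
Proof.
move=> dD ext sA.
suff H : q <= \sum_(x in A) d x -> 2 * (#|F| + q) <= b ->
  exists (B : {set T}) d', [/\ [disjoint B & F], #|B| = q, B \subset nbs e A &
    [/\ extendable (B :|: F) d', forall x, d' x <= D,
        forall x, x \notin A -> d' x = d x &
        \sum_(x in A) d' x + q = \sum_(x in A) d x]].
  move=> h1 h2; have [B [d' [? ? ? [? ? ? ?]]]] := H h1 h2.
  by exists B, d'; split.
elim: q => [|q IH] hq hb.
  exists set0, d; rewrite cards0 sub0set set0U addn0 -setI_eq0 set0I eqxx.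
  by split.
have [||B [d' [dBF cB sB [ext' dD' off sum]]]] := IH; [by arith..|].
have [v vA dv] : exists2 v, v \in A & 0 < d' v.
  case: (pickP [pred v in A | 0 < d' v]) => [v /andP[? ?]|h]; first by exists v.
  have : \sum_(x in A) d' x = 0.
    by apply: big1 => x xA; apply/eqP; move: (h x); rewrite /= xA lt0n => /negbFE.
  by arith.
have cBF : #|B :|: F| = q + #|F|.
  by rewrite cardsU -cB; move: dBF; rewrite -setI_eq0 => /eqP ->; rewrite cards0 subn0.
have hb' : 2 * #|B :|: F| <= b by arith.
have [w [vw wF ext'']] := extend_vertex dD' b_gt0 hb' ext' (subsetP sA v vA) dv.
exists (w |: B), (fun x => d' x - (x == v)).
have [wB wF'] : w \notin B /\ w \notin F by apply/andP; rewrite -negb_or -in_setU.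
split.
- by apply/disjointP => x /setU1P[-> //|/(disjointFr dBF) ->].
- by rewrite cardsU1 wB cB add1n.
- by rewrite subUset sB sub1set andbT; apply/nbsP; exists v.
split=> [||x xA|].
- by rewrite -setUA.
- by move=> x; rewrite (leq_trans (leq_subr _ _)).
- by rewrite off //; case: eqP xA => [->|]; rewrite ?vA ?subn0.
rewrite -sum !(big_setD1 v vA) /= eqxx.
have -> : \sum_(i in A :\ v) (d' i - (i == v)) = \sum_(i in A :\ v) d' i.
  by apply: eq_bigr => i /setD1P[/negbTE -> _]; rewrite subn0.
by arith.
Qed.

(** Every step charges one child to the current endpoint. The new endpoint comes from outside the
    embedded set, so it is still owed [D]; in particular the last vertex of the path can serve as
    the root of a tree. *)
Lemma extend_path q F d r :
  (forall x, d x <= D) -> extendable F d -> r \in R -> r \in F -> d r = D -> 0 < D ->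
  (forall x, x \notin F -> d x = D) -> 2 * (#|F| + q) <= b ->
  exists p d', [/\ path e r p, size p = q, uniq p, [disjoint p & F] &
    [/\ extendable ([set x in p] :|: F) d', forall x, d' x <= D,
        forall x, x \notin r :: p -> d' x = d x & d' (last r p) = D]].
Proof.
elim: q F d r => [|q IH] F d r dD ext rR rF dr D0 out hb.
  exists [::], d; split=> //; first by apply/pred0P.
  split=> //; suff -> : [set x in [::]] = set0 :> {set T} by rewrite set0U.
  by apply/setP => x; rewrite !inE.
have [||w [rw wF ext']] := extend_vertex dD b_gt0 _ ext rR; rewrite ?dr //; first by arith.
have [|||||||p [d' [pp sp up dp [ext'' dD' off dl]]]] :=
  IH (w |: F) (fun x => d x - (x == r)) w _ ext'.
- by move=> x; rewrite (leq_trans (leq_subr _ _)).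
- exact: edgeR rw.
- exact: setU11.
- by rewrite out //; case: eqP wF => [->|]; rewrite ?rF ?subn0.
- by [].
- move=> x; rewrite !inE negb_or => /andP[_ xF].
  by rewrite out //; case: eqP xF => [->|]; rewrite ?rF ?subn0.
- by rewrite cardsU1 wF; arith.
have wp : w \notin p.
  by apply/negP => wp; have := disjointFr dp wp; rewrite setU11.
exists (w :: p), d'; split=> //=; rewrite ?rw ?sp ?wp //.
  rewrite disjoint_cons wF /=; apply: disjointWr dp; exact: subsetU1.
split=> //.
- congr (extendable _ d'): ext''; apply/setP => x; rewrite !inE.
  by rewrite orbCA orbA.
- move=> x xn; rewrite off; last by move: xn; rewrite !inE !negb_or => /and3P[_ -> ->].
  by move: xn; rewrite !inE !negb_or => /andP[/negbTE -> _]; rewrite subn0.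
Qed.

(** A tree of depth [j - 1] with [a' = ceil(a / D)] leaves receives a last layer of [a] children.
    Since [10 <= D], levels shrink at least tenfold towards the root up to rounding, whence at most
    [1.2 * a + 3 * j] vertices. Of the tree only the root-to-leaf paths are kept. *)
Lemma extend_tree j a F d r : 10 <= D -> 0 < a -> a <= D ^ j ->
  (forall x, d x <= D) -> extendable F d -> r \in R -> r \in F -> d r = D ->
  (forall x, x \notin F -> d x = D) -> 20 * #|F| + 24 * a + 60 * j <= 10 * b ->
  exists (B L : {set T}) d', [/\ [disjoint B & F], L \subset r |: B, #|L| = a,
      10 * #|B| <= 12 * a + 30 * j &
    [/\ extendable (B :|: F) d', forall x, d' x <= D,
        forall x, x \notin r |: B -> d' x = d x, forall x, x \in L -> d' x = D &
        forall u, u \in L -> exists p, [/\ path e r p, uniq (r :: p), size p = j,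
          last r p = u & {subset p <= B}]]].
Proof.
move=> D10; elim: j a => [|j IH] a a0 aD dD ext rR rF dr out hb.
  have -> : a = 1 by move: aD; rewrite expn0; arith.
  exists set0, [set r], d; rewrite cards0 cards1 set0U setU0; split=> //.
    by rewrite -setI_eq0 set0I.
  split=> // [x /set1P -> //|u /set1P ->].
  by exists [::].
set a' := (a.-1 %/ D).+1.
have D0 : 0 < D by arith.
have ha1 : a.-1 %/ D * D <= a.-1 by rewrite leq_trunc_div.
have ha2 : 10 * (a.-1 %/ D) <= a.-1.
  by rewrite (leq_trans _ ha1) // mulnC leq_mul2l D10 orbT.
have ha3 : a <= a' * D by have := ltn_ceil a.-1 D0; rewrite -/a'; arith.
have ha4 : a' <= D ^ j by rewrite /a' ltn_divLR // -expnSr; arith.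
have [||B [L [d' [dBF sL cL cB [ext' dD' off dL pL]]]]] := IH a' _ ha4 dD ext rR rF dr out.
  by [].
  by rewrite /a'; arith.
have sLR : L \subset R.
  apply/subsetP => u /pL[p [pp _ _ <- _]].
  by case/lastP: p pp => [|p z] //; rewrite rcons_path last_rcons => /andP[_ /edgeR].
have cBF : #|B :|: F| = #|B| + #|F|.
  by rewrite cardsU; move: dBF; rewrite -setI_eq0 => /eqP ->; rewrite cards0 subn0.
have [||C [d'' [dC cC sC [ext'' dD'' off'']]]] :=
    @extend_children (B :|: F) d' L a dD' ext' sLR.
- have -> : \sum_(x in L) d' x = a' * D.
    by rewrite (eq_bigr (fun=> D)) ?sum_nat_const ?cL // => x /dL.
  by [].
- by rewrite cBF; rewrite /a' in cB; arith.
have CB x : x \in C -> (x \notin B) * (x \notin F).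
  by move=> xC; have := disjointFr dC xC; rewrite inE => /norP[-> ->].
have Cr x : x \in C -> x \notin r |: B.
  move=> xC; rewrite inE negb_or (CB x xC) andbT inE.
  by apply: contraTneq rF => <-; rewrite (CB x xC).
exists (C :|: B), C, d''; split=> //.
- by apply/disjointP => x /setUP[/CB[_ ->]|/(disjointFr dBF) ->].
- by rewrite setUCA subsetUl.
- have : #|C :|: B| <= a + #|B| by rewrite -cC (leq_card_setU C B).1.
  by rewrite /a' in cB; arith.
split=> //.
- by rewrite -setUA.
- move=> x; rewrite setUCA inE negb_or => /andP[xC xB].
  by rewrite off'' ?off //; apply: contra xB; apply: subsetP sL x.
- move=> x xC; have xB := Cr x xC.
  rewrite off'' ?off ?out ?(CB x xC) //; by apply: contra xB; apply: subsetP sL x.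
move=> u uC; have /nbsP[v vL vu] := subsetP sC u uC.
have [p [pp up sp lp subp]] := pL v vL.
exists (rcons p u); rewrite rcons_path pp lp size_rcons sp last_rcons; split=> //.
  rewrite -rcons_cons rcons_uniq up andbT inE negb_or.
  have := Cr u uC; rewrite !inE negb_or => /andP[-> uB] /=.
  by apply: contra uB; apply: subp.
by move=> x; rewrite mem_rcons !inE => /orP[/eqP ->|/subp ->]; rewrite ?uC ?orbT.
Qed.

End Embedding.

(** * Connections of exact length *)

Section Connecting.
Variables (T : finType) (g : rel T).
Hypothesis gs : symmetric g.

Lemma join_paths (e : rel T) x y p q : symmetric e ->
  path e x p -> path e y q -> e (last x p) (last y q) ->
  uniq (x :: p ++ y :: q) ->
  exists r, [/\ path e x r, last x r = y, size r = (size p + size q).+1 &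
     perm_eq (x :: r) (x :: p ++ y :: q)].
Proof.
move=> es pp pq el un; exists (p ++ rev (y :: q)).
rewrite lastI rev_rcons last_cat cat_path pp /= el /= rev_path.
rewrite (eq_path (e' := e)); last by move=> u v; apply: es.
rewrite pq size_cat /= size_rev size_belast addnS; split=> //.
  by case: q {pq el un} => [|z q] //=; rewrite rev_cons last_rcons.
by rewrite perm_cons perm_cat2l -rev_rcons -lastI perm_rev.
Qed.

(* A failure of expansion in [R0 :\: X] enlarges a non-expanding [X] that must
   stay below size [s], since larger sets see almost all of [R1]. *)
Lemma core_step s f b (R0 R1 X Y Z : {set T}) : joined g s R0 R1 ->
  X \subset R0 -> #|X| <= s -> #|Y| <= s ->
  #|nbs g X :&: (R1 :\: Y)| <= f * #|X| -> f * b + 2 * s + f * s <= #|R1| ->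
  Z \subset R0 :\: X -> #|Z| <= b -> #|nbs g Z :&: (R1 :\: Y)| < f * #|Z| ->
  [/\ #|X :|: Z| <= s, #|nbs g (X :|: Z) :&: (R1 :\: Y)| <= f * #|X :|: Z| &
      #|X| < #|X :|: Z|].
Proof.
move=> j sX cX cY nX hR sZ cZ nZ.
have cXZ : #|X :|: Z| = #|X| + #|Z|.
  rewrite cardsU; suff -> : X :&: Z = set0 by rewrite cards0 subn0.
  apply/eqP; rewrite setI_eq0 disjoint_sym; apply/disjointP => x /(subsetP sZ).
  by case/setDP.
have nXZ : #|nbs g (X :|: Z) :&: (R1 :\: Y)| <= f * #|X| + f * #|Z|.
  rewrite nbsU setIUl; apply: leq_trans (leq_card_setU _ _).1 _.
  by rewrite leq_add // ltnW.
have Zp : 0 < #|Z| by case: #|Z| nZ; rewrite ?muln0.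
split; last 2 first.
- by rewrite cXZ mulnDr.
- by arith.
rewrite leqNgt; apply/negP => big.
have sXZ : X :|: Z \subset R0.
  by rewrite subUset sX (subset_trans sZ) // subsetDl.
have := joined_nbs j sXZ (ltnW big).
have : #|R1| <= #|R1 :\: nbs g (X :|: Z)| + (#|nbs g (X :|: Z) :&: (R1 :\: Y)| + #|Y|).
  rewrite -(cardsID (nbs g (X :|: Z)) R1) addnC leq_add2l.
  apply: leq_trans (leq_card_setU _ _).1; apply: subset_leq_card.
  apply/subsetP => x /setIP[x1 x2]; rewrite in_setU in_setI x2 in_setD x1 andbT.
  by case: (x \in Y).
have : f * #|X| <= f * s by rewrite leq_mul2l cX orbT.
have : f * #|Z| <= f * b by rewrite leq_mul2l cZ orbT.
by arith.
Qed.

(** Among pairs of non-expanding sets of size at most [s], one of maximal total size is deleted; by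
    [core_step] a remaining violation on either side would enlarge it. Neighbours are counted
    outside the other deleted set, so enlarging one set cannot spoil the condition on the other. *)
Lemma expanding_core s f b (R0 R1 : {set T}) : joined g s R0 R1 ->
  f * b + 2 * s + f * s <= #|R0| -> f * b + 2 * s + f * s <= #|R1| ->
  exists W0 W1 : {set T}, [/\ W0 \subset R0, W1 \subset R1,
    #|R0 :\: W0| <= s, #|R1 :\: W1| <= s &
    (forall X : {set T}, X \subset W0 -> #|X| <= b -> f * #|X| <= #|nbs g X :&: W1|) /\
    (forall X : {set T}, X \subset W1 -> #|X| <= b -> f * #|X| <= #|nbs g X :&: W0|)].
Proof.
move=> jn h0 h1.
pose ok (Q : {set T} * {set T}) :=
  [&& Q.1 \subset R0, #|Q.1| <= s, Q.2 \subset R1, #|Q.2| <= s &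
   (#|nbs g Q.1 :&: (R1 :\: Q.2)| <= f * #|Q.1|) &&
   (#|nbs g Q.2 :&: (R0 :\: Q.1)| <= f * #|Q.2|)].
have ok0 : ok (set0, set0).
  by rewrite /ok /= !sub0set cards0 nbs0 !set0I cards0.
case: (arg_maxnP (fun Q : {set T} * {set T} => #|Q.1| + #|Q.2|) ok0) => -[X Y].
case/and5P => /= sX cX sY cY /andP[nX nY] max.
have DD (A B : {set T}) : B \subset A -> A :\: (A :\: B) = B.
  by move=> sBA; rewrite setDDr setDv set0U (setIidPr sBA).
exists (R0 :\: X), (R1 :\: Y); rewrite !subsetDl !DD //; split=> //.
split=> Z sZ cZ; rewrite leqNgt; apply/negP => nZ.
- have [c n l] := core_step jn sX cX cY nX h1 sZ cZ nZ.
  have := max (X :|: Z, Y) => /=; rewrite /ok /= c sY cY n.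
  rewrite subUset sX (subset_trans sZ) ?subsetDl //=.
  rewrite (leq_trans _ nY) => [/(_ isT)|]; first by arith.
  by apply: subset_leq_card; rewrite setIS // setDS // subsetUl.
- have [c n l] := core_step (joined_sym gs jn) sY cY cX nY h0 sZ cZ nZ.
  have := max (X, Y :|: Z) => /=; rewrite /ok /= c sX cX n andbT.
  rewrite subUset sY (subset_trans sZ) ?subsetDl //=.
  rewrite (leq_trans _ nX) => [/(_ isT)|]; first by arith.
  by apply: subset_leq_card; rewrite setIS // setDS // subsetUl.
Qed.

Lemma proper_colour (e : rel T) (c : pred T) x p :
  (forall u v, e u v -> c u != c v) -> path e x p ->
  c (last x p) = c x (+) odd (size p).
Proof.
move=> ec; elim: p x => [|y p IH] x /=; first by rewrite addbF.
by move=> /andP[/ec xy /IH ->]; case: (c x) (c y) (odd _) xy => [] [] [].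
Qed.

Lemma exact_connection D s a j (R0 R1 : {set T}) : [disjoint R0 & R1] ->
  joined g s R0 R1 -> 10 <= D -> 0 < a -> a <= D ^ j -> 2 * s + 5 * a <= 2 * (D.+2 * a) ->
  D.+2 * (5 * a) + 2 * s + D.+2 * s <= #|R0| ->
  D.+2 * (5 * a) + 2 * s + D.+2 * s <= #|R1| ->
  exists W0 W1 : {set T}, [/\ W0 \subset R0, W1 \subset R1,
    #|R0 :\: W0| <= s, #|R1 :\: W1| <= s &
    forall x y l, x \in W0 -> y \in W1 -> ~~ odd l -> 60 * j + 20 + 10 * l <= a ->
    exists p, [/\ path g x p, uniq (x :: p), last x p = y, size p = 2 * j + 3 + l &
                  {subset x :: p <= W0 :|: W1}]].
Proof.
move=> dR jn D10 a0 aD hs h0 h1.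
have [W0 [W1 [s0 s1 c0 c1 [ex0 ex1]]]] := expanding_core jn h0 h1.
exists W0, W1; split=> // x y l xW yW l_even hl.
have dW : [disjoint W0 & W1].
  apply/disjointP => z /(subsetP s0)/(disjointFr dR) zR1.
  by apply: contraFN zR1; apply: subsetP s1 z.
pose W := W0 :|: W1; pose c := [pred v | v \in W1].
have cW0 v : v \in W0 -> c v = false by move/(disjointFr dW).
(* Only edges crossing between [W0] and [W1] are used, so the side of a vertex is determined by the
   parity of its distance along a path. *)
pose e : rel T := fun u v => [&& g u v, u \in W, v \in W & c u != c v].
have es : symmetric e.
  by move=> u v; rewrite /e gs eq_sym; case: (u \in W); case: (v \in W).
have ec u v : e u v -> c u != c v by case/and4P.
have eW u v : e u v -> v \in W by case/and4P.
have eg : subrel e g by move=> u v /and4P[].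
have nW0 (X : {set T}) : X \subset W0 -> nbs e X = nbs g X :&: W1.
  move=> sX; apply/setP => v; rewrite in_setI; apply/nbsP/andP.
    case=> u uX uv; split; first by apply/nbsP; exists u => //; apply: eg.
    by move/ec: uv; rewrite cW0 ?(subsetP sX) //=; case: (v \in W1).
  case=> /nbsP[u uX uv] vW; exists u => //; have uW := subsetP sX u uX.
  by rewrite /e uv !inE uW vW orbT (disjointFr dW uW).
have nW1 (X : {set T}) : X \subset W1 -> nbs e X = nbs g X :&: W0.
  move=> sX; apply/setP => v; rewrite in_setI; apply/nbsP/andP.
    case=> u uX uv; split; first by apply/nbsP; exists u => //; apply: eg.
    have uW1 : u \in W1 := subsetP sX u uX.
    have := eW _ _ uv; have := ec _ _ uv; rewrite in_setU /= uW1.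
    by case: (v \in W1); rewrite ?orbF.
  case=> /nbsP[u uX uv] vW; exists u => //; have uW := subsetP sX u uX.
  by rewrite /e uv !inE uW vW orbT (disjointFr dW vW).
(* The path and the two trees have at most [2.4 * a + 6 * j + l + 2] vertices in all, and the
   extension lemmas need [b] to be at least twice that. The assumed lower bound on [a] makes [5 * a]
   enough. *)
set b := 5 * a; have b0 : 0 < b by rewrite /b; arith.
have expand (X : {set T}) : X \subset W -> #|X| <= b -> D.+2 * #|X| <= #|nbs e X|.
  move=> sX cX.
  have eX : X = (X :&: W0) :|: (X :&: W1) by rewrite -setIUr; apply/esym/setIidPl.
  have cI i : #|X :&: i| <= b by rewrite (leq_trans _ cX) // subset_leq_card // subsetIl.
  have := ex0 _ (subsetIr X W0) (cI W0); have := ex1 _ (subsetIr X W1) (cI W1).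
  rewrite eX nbsU nW0 ?subsetIr // nW1 ?subsetIr // !cardsU.
  have -> : X :&: W0 :&: (X :&: W1) = set0.
    by apply/setP => z; rewrite !inE; case z0: (z \in W0); rewrite ?andbF //= (disjointFr dW z0) !andbF.
  have -> : forall A B : {set T}, A :&: W1 :&: (B :&: W0) = set0.
    by move=> A B; apply/setP => z; rewrite !inE; case z0: (z \in W0); rewrite ?andbF //= (disjointFr dW z0) !andbF.
  rewrite !cards0 !subn0 -eX; by arith.
have xR : x \in W by rewrite inE xW.
have yR : y \in W by rewrite inE yW orbT.
have xy : x != y by apply: contraTneq yW => <-; rewrite (disjointFr dW xW).
have cF0 : #|[set x; y]| = 2 by rewrite cards2 xy.
(* The factor [D.+2] pays for the two vertices embedded at the start: a nonempty [X] loses at most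
   two neighbours to them. *)
have ext0 : extendable e W b [set x; y] (fun=> D).
  apply/forallP => X; apply/implyP => /andP[sX cX]; rewrite sum_nat_const mulnC.
  have := expand _ sX cX; have := cardsID [set x; y] (nbs e X).
  have : #|nbs e X :&: [set x; y]| <= 2 by rewrite -cF0 subset_leq_card // subsetIr.
  have [->|/set0Pn[z zX]] := eqVneq X set0; first by rewrite cards0 !muln0.
  by have : 0 < #|X| by [rewrite (cardD1 z) zX]; arith.
have [||p [d1 [pp sp up dp [ext1 dD1 off1 dl1]]]] :=
  @extend_path _ e W D b expand eW b0 l [set x; y] (fun=> D) y
    (fun=> leqnn _) ext0 yR (set22 _ _) erefl _ (fun _ _ => erefl).
- by arith.
- by rewrite cF0 /b; arith.
set y' := last y p in dl1; set F1 := _ :|: _ in ext1.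
have pF1 z : z \in p -> z \in F1 by move=> zp; rewrite !inE zp.
have xF1 : x \in F1 by rewrite !inE eqxx orbT.
have yF1 : y \in F1 by rewrite !inE eqxx !orbT.
have y'F1 : y' \in F1.
  by have := mem_last y p; rewrite -/y' inE => /predU1P[->|/pF1].
have pW z : z \in y :: p -> z \in W.
  rewrite inE => /predU1P[-> //|].
  elim: (p) (y) pp => //= u q IH v /andP[/eW uW pq]; rewrite inE => /predU1P[-> //|].
  exact: IH pq.
have xp : x \notin y :: p.
  rewrite inE negb_or xy /=; apply/negP => xp; have := disjointFr dp xp.
  by rewrite set21.
have y'p : y' \in y :: p by apply: mem_last.
have cF1 : #|F1| <= l + 2.
  apply: leq_trans (leq_card_setU _ _).1 _; rewrite cF0 leq_add2r -sp cardsE.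
  exact: card_size.
have out1 z : z \notin F1 -> d1 z = D.
  rewrite !inE !negb_or => /and3P[zp zx zy]; rewrite off1 // inE negb_or zy.
  by [].
have [||Bx [Lx [d2 [dBx sLx cLx cBx [ext2 dD2 off2 dLx pLx]]]]] :=
  @extend_tree _ e W D b expand eW b0 j a F1 d1 x D10 a0 aD dD1 ext1 xR xF1 _ out1.
- by rewrite off1.
- by rewrite /b; arith.
have cF2 : #|Bx :|: F1| <= #|Bx| + #|F1| := (leq_card_setU _ _).1.
have y'F2 : y' \in Bx :|: F1 by rewrite in_setU y'F1 orbT.
have y'x : y' \notin x |: Bx.
  rewrite inE negb_or in_set1 (disjointFl dBx y'F1) andbT.
  by apply: contraNneq xp => <-.
have [|||By [Ly [d3 [dBy sLy cLy cBy [ext3 dD3 off3 dLy pLy]]]]] :=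
  @extend_tree _ e W D b expand eW b0 j a (Bx :|: F1) d2 y' D10 a0 aD dD2 ext2
     (pW _ y'p) y'F2.
- by rewrite off2.
- move=> z; rewrite inE negb_or => /andP[zB zF]; rewrite off2 ?out1 //.
  by rewrite inE negb_or in_set1 zB andbT; apply: contraNneq zF => ->.
- by rewrite /b; arith.
set F3 := By :|: (Bx :|: F1).
have cF3 : #|F3| <= #|By| + #|Bx :|: F1| := (leq_card_setU _ _).1.
have sWy : Ly \subset W.
  apply/subsetP => u /pLy[q [pq _ _ <- _]]; move: pq (pW _ y'p).
  by elim: q (y') => //= v q IH z /andP[/eW vW /IH]; auto.
have sWx : Lx \subset W.
  apply/subsetP => u /pLx[q [pq _ _ <- _]]; move: pq xR.
  by elim: q (x) => //= v q IH z /andP[/eW vW /IH]; auto.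
(* At most [2.5 * a] of the [(D + 2) * a] neighbours are already embedded; the hypothesis [hs] says
   that [s] of them remain. *)
have big (L : {set T}) : L \subset W -> #|L| = a -> s <= #|nbs e L :\: F3|.
  move=> sL cL; have := cardsID F3 (nbs e L).
  have := subset_leq_card (subsetIr (nbs e L) F3).
  have := expand L sL; rewrite cL => /(_ _); have -> : a <= b by rewrite /b; arith.
  by move=> /(_ isT); arith.
have cx : c x = false by apply: cW0.
have cy' : c y' = true.
  by rewrite /y' (proper_colour ec pp) sp (negbTE l_even) addbF.
have colx v : v \in nbs e Lx :\: F3 -> c v = ~~ odd j.
  case/setDP => /nbsP[u /pLx[q [pq _ sq <- _]] /ec] + _.
  by rewrite (proper_colour ec pq) cx sq; case: (odd j); case: (c v).
have coly v : v \in nbs e Ly :\: F3 -> c v = odd j.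
  case/setDP => /nbsP[u /pLy[q [pq _ sq <- _]] /ec] + _.
  by rewrite (proper_colour ec pq) cy' sq; case: (odd j); case: (c v).
have nW u (L : {set T}) : u \in nbs e L :\: F3 -> u \in W by case/setDP => /nbsP[v _ /eW].
(* As [l] is even, [x] and [y'] lie on opposite sides, hence so do the vertices [j + 1] steps away
   from them; the parity of [j] decides which is on which side. The resulting path has length
   [(j + 1) + 1 + (j + 1) + l]. *)
have [u1 [w1 [u1N w1N u1w1]]] : exists u1 w1, [/\ u1 \in nbs e Lx :\: F3,
    w1 \in nbs e Ly :\: F3 & g u1 w1].
  have inW0 v : v \in W -> c v = false -> v \in R0.
    by move=> + vW1; rewrite inE; move: vW1 => /= ->; rewrite orbF => /(subsetP s0).
  have inW1 v : c v = true -> v \in R1 by move=> /(subsetP s1).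
  case oj: (odd j) colx coly => colx coly.
  - apply: jn (big _ sWx cLx) (big _ sWy cLy); apply/subsetP => v vN.
      by rewrite inW0 ?(nW _ _ vN) ?colx.
    by rewrite inW1 ?coly.
  - apply: (joined_sym gs jn) (big _ sWx cLx) (big _ sWy cLy); apply/subsetP => v vN.
      by rewrite inW1 ?colx.
    by rewrite inW0 ?(nW _ _ vN) ?coly.
have e_uw : e u1 w1.
  by rewrite /e u1w1 (nW _ _ u1N) (nW _ _ w1N) colx // coly //; case: (odd j).
have u1w1' : u1 != w1.
  by apply: contraTneq e_uw => ->; rewrite /e eqxx !andbF.
case/setDP: (u1N) => /nbsP[u uLx eu] u1F3; case/setDP: (w1N) => /nbsP[w wLy ew] w1F3.
have [px [ppx upx spx lpx subpx]] := pLx u uLx.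
have [py [ppy upy spy lpy subpy]] := pLy w wLy.
have F13 z : z \in F1 -> z \in F3 by move=> zF; rewrite in_setU (in_setU _ Bx) zF !orbT.
have ypF1 z : z \in y :: p -> z \in F1 by rewrite inE => /predU1P[->|/pF1].
have Un : uniq (x :: rcons px u1 ++ y :: (p ++ rcons py w1)).
  rewrite (perm_uniq (s2 := u1 :: w1 :: ((x :: px) ++ (y :: p) ++ py))); last first.
    apply/permP => P; rewrite -!cats1 /= !count_cat /= !count_cat /=; arith.
  have notF3 z : z \notin F3 -> z \notin (x :: px) ++ (y :: p) ++ py.
    apply: contraNN; rewrite !mem_cat => /or3P[|/ypF1/F13 //|/subpy zB].
      rewrite inE => /predU1P[->|/subpx zB]; first exact: F13.
      by rewrite in_setU (in_setU _ Bx) zB orbT.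
    by rewrite in_setU zB.
  have -> : uniq (u1 :: w1 :: (x :: px) ++ (y :: p) ++ py) =
    uniq ((x :: px) ++ (y :: p) ++ py).
    by rewrite 2!cons_uniq inE negb_or u1w1' !notF3.
  have Byn z : z \in py -> (z \notin Bx) * (z \notin F1).
    by move/subpy/(disjointFr dBy); rewrite in_setU => /norP[-> ->].
  have yp : y \notin p by apply/negP => yp; have := disjointFr dp yp; rewrite set22.
  have upy' : uniq py by case/andP: upy.
  have uyp : uniq (y :: p) by rewrite /= yp.
  rewrite cat_uniq upx cat_uniq uyp upy' andbT !andTb.
  apply/andP; split; apply/hasPn => z; last first.
    by move/Byn => [_]; apply: contraNN => /ypF1.
  rewrite mem_cat => zp; apply/negP; rewrite inE => /predU1P[zx|/subpx zBx].
    case/orP: zp => [|/Byn[_]]; rewrite zx ?xF1 //; exact/negP.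
  case/orP: zp => [/ypF1|/Byn[]]; first by rewrite (disjointFr dBx zBx).
  by rewrite zBx.
have [||//|r [pr lr sr per]] := join_paths (e := e) es _ _ _ Un.
- by rewrite rcons_path ppx lpx.
- by rewrite cat_path pp rcons_path ppy -/y' lpy.
- by rewrite last_cat !last_rcons.
exists r; split=> //.
- exact: sub_path pr.
- by rewrite (perm_uniq per).
- by rewrite sr size_cat !size_rcons spx spy sp; arith.
move=> z; rewrite inE => /predU1P[-> //|].
elim: (r) (x) pr => //= u' q IH v /andP[/eW uW pq]; rewrite inE => /predU1P[-> //|].
exact: IH pq.
Qed.

End Connecting.

(** * Almost spanning paths *)

Section LongPaths.
Variables (T : finType) (e : rel T) (c : pred T) (s : nat).
Hypothesis es : symmetric e.
Hypothesis ec : forall u v, e u v -> c u != c v.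

Lemma count_colour x p : path e x p ->
  count c (x :: p) = if c x then uphalf (size p).+1 else (size p).+1./2.
Proof.
elim: p x => [|y p IH] x; first by rewrite /=; case: (c x).
move=> /= /andP[/ec xy /IH]; rewrite /= => ->.
by case: (c x) (c y) xy => [] [].
Qed.

Lemma count_sorted p : sorted e p ->
  (size p)./2 <= count c p <= uphalf (size p) /\
  (size p)./2 <= count (predC c) p <= uphalf (size p).
Proof.
case: p => // x p px; have := count_colour px; have := count_predC c (x :: p).
have := odd_double_half (size p); rewrite !uphalf_half /=.
rewrite uphalf_half; case: (c x); case: (odd _) => /=; arith.
Qed.

Lemma card_mem_count (A : {set T}) (p : seq T) : uniq p ->
  #|[set x in p] :&: A| = count (mem A) p.
Proof.
move=> up; rewrite -size_filter -(card_uniqP (filter_uniq _ up)).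
by apply: eq_card => x; rewrite !inE mem_filter andbC.
Qed.

(* Depth-first search with finished vertices [S] and stack [p]: every step
   increases [2 * #|S| + size p] by one, so the search can be stopped when there
   are as many finished as unvisited vertices. *)
Lemma dfs_state (V : {set T}) q : q <= 2 * #|V| ->
  exists (S : {set T}) (p : seq T), [/\ sorted e p, uniq p, {subset p <= V}, S \subset V &
    [/\ [disjoint S & p], 2 * #|S| + size p = q &
    forall x y, x \in S -> y \in V -> e x y -> (y \in S) || (y \in p)]].
Proof.
elim: q => [|q IH] hq.
  exists set0, [::]; rewrite cards0; split=> //; first exact: sub0set.
  split=> //; first by apply/disjointP => x; rewrite inE.
  by move=> x y; rewrite inE.
have [S [p [sp up pV SV [dSp cS none]]]] := IH (ltnW hq).
case: p sp up pV dSp cS none => [|x p] sp up pV dSp cS none.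
  have : 0 < #|V :\: S| by have := cardsID S V; rewrite (setIidPr SV); move: cS => /=; arith.
  case/card_gt0P => y /setDP[yV yS]; exists S, [:: y]; split=> //.
    by move=> z; rewrite inE => /eqP ->.
  split; first by rewrite disjoint_sym disjoint_cons yS; apply/disjointP.
    by move: cS => /=; arith.
  by move=> u v uS vV uv; have := none u v uS vV uv; rewrite orbF => ->.
case: (pickP [pred y in V | [&& e x y, y \notin S & y \notin x :: p]]) => [y|h].
  case/and4P => yV xy yS yp; exists S, (y :: x :: p); split=> //.
  - by rewrite /= es xy.
  - by rewrite cons_uniq yp.
  - by move=> z; rewrite inE => /predU1P[->|/pV].
  split; first by rewrite disjoint_sym disjoint_cons yS disjoint_sym.
    by rewrite /= addnS cS.
  move=> u v uS vV uv; have /orP[->//|vp] := none u v uS vV uv.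
  by rewrite [v \in y :: _]inE vp !orbT.
have xS : x \notin S by apply/negP => /(disjointFr dSp); rewrite mem_head.
exists (x |: S), p; split.
- exact: path_sorted sp.
- by case/andP: up.
- by move=> z zp; apply: pV; rewrite inE zp orbT.
- by rewrite subUset SV sub1set pV ?mem_head.
split.
- apply/disjointP => z /setU1P[->|/(disjointFr dSp)]; first by case/andP: up.
  by rewrite inE => /norP[].
- by rewrite cardsU1 xS; move: cS => /=; arith.
move=> u v /setU1P[->|uS] vV uv; last first.
  have := none u v uS vV uv; rewrite !inE => /or3P[]->; by rewrite ?orbT.
have := h v; rewrite /= vV uv !inE /=; case: (v == x) => //=.
by case: (v \in S) => //=; case: (v \in p).
Qed.

(** After [2 * w] steps of the search the finished set [S] and the unvisited set [U] have equal
    size, and no edge crosses from [S] to [U]. Since the stack alternates between [A] and [B],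
    little can then lie off the stack. *)
Lemma dfs_path (A B : {set T}) w : 2 * s < w -> #|A| = w -> #|B| = w ->
  {in A, forall x, ~~ c x} -> {in B, forall x, c x} -> joined e s A B ->
  exists x p, [/\ path e x p, uniq (x :: p), {subset x :: p <= A :|: B}, x \in A &
    2 * w <= (size p).+1 + 4 * s].
Proof.
move=> sw cA cB hA hB jn; set V := A :|: B.
have AB : A :&: B = set0.
  by apply/eqP; rewrite setI_eq0; apply/disjointP => x /hA; apply: contra => /hB.
have cV : #|V| = 2 * w by rewrite cardsU AB cards0 cA cB; arith.
have [|S [p [sp up pV SV [dSp cS none]]]] := @dfs_state V (2 * w); first by rewrite cV; arith.
set P := [set x in p]; set U := V :\: (S :|: P).
have SP : S :&: P = set0.
  apply/eqP; rewrite setI_eq0; apply/disjointP => x /(disjointFr dSp) xp.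
  by rewrite inE xp.
have cP : #|P| = size p by rewrite cardsE; apply/card_uniqP.
have part (X : {set T}) : X \subset V -> #|X| = #|X :&: S| + #|X :&: P| + #|X :&: U|.
  move=> sX; rewrite -(cardsID (S :|: P) X) setIUr cardsU.
  have -> : X :&: S :&: (X :&: P) = set0 by rewrite setIACA SP setI0.
  by rewrite cards0 subn0 /U setIDA (setIidPl sX).
have noSU (X Y : {set T}) : joined e s X Y -> X \subset V -> Y \subset V ->
    #|X :&: S| < s \/ #|Y :&: U| < s.
  move=> j sX sY; have [?|h1] := ltnP #|X :&: S| s; first by left.
  have [?|h2] := ltnP #|Y :&: U| s; first by right.
  have [x [y [/setIP[_ xS] /setIP[_ /setDP[yV ySP]] xy]]] :=
    j _ _ (subsetIl _ _) (subsetIl _ _) h1 h2.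
  by have := none x y xS yV xy; move: ySP; rewrite !inE => /negbTE ->.
have sA : A \subset V by apply: subsetUl.
have sB : B \subset V by apply: subsetUr.
have n1 := noSU _ _ jn sA sB.
have n2 := noSU _ _ (joined_sym es jn) sB sA.
have pA := part A sA; have pB := part B sB.
have tot : #|S| = #|A :&: S| + #|B :&: S|.
  rewrite -{1}(setIidPr SV) /V setIUl cardsU.
  by rewrite setIACA AB set0I cards0 subn0.
have [cntB cntA] := count_sorted sp.
have eB : #|B :&: P| = count c p.
  rewrite setIC card_mem_count //; apply: eq_in_count => x /pV.
  rewrite inE => /orP[xA|xB]; last by rewrite /= xB hB.
  by rewrite /= (negbTE (hA x xA)); apply/negP => /hB; apply/negP/hA.
have eA : #|A :&: P| = count (predC c) p.
  rewrite setIC card_mem_count //; apply: eq_in_count => x /pV.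
  rewrite inE => /orP[xA|xB]; first by rewrite /= xA hA.
  by rewrite /= hB //; apply/negP => /hA; rewrite hB.
(* Of [A :&: S] and [B :&: U] one is smaller than [s], and likewise for [B :&: S] and [A :&: U].
   Either [S] or [U] is then smaller than [2 * s], or one side has fewer than [2 * s] vertices off
   the stack and the alternation transfers this to the other. *)
have main : 2 * w < size p + 4 * s.
  have := odd_double_half (size p); move: cntA cntB; rewrite uphalf_half.
  rewrite -eA -eB; move: n1 n2 pA pB cS; rewrite tot cA cB.
  by case: (odd _) => /=; clear; lia.
case: p sp up pV {dSp cS none P U SP cP part noSU n1 n2 pA pB cntA cntB eA eB} main
  => [|x p] sp up pV main; first by move: main => /=; arith.
have hx : x \in V by apply: pV; rewrite mem_head.
case cx: (c x); last first.
  exists x, p; split=> //; last by move: main => /=; arith.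
  by move: hx; rewrite inE => /orP[//|/hB]; rewrite cx.
(* A path that starts in [B] gives up its first vertex, which the strict inequality [main]
   allows. *)
case: p sp up pV main => [|y p] sp up pV main; first by move: main => /=; arith.
have yx : c y = false by case/andP: sp => /ec; rewrite cx; case: (c y).
exists y, p; split.
- by case/andP: sp.
- by case/andP: up.
- by move=> z zp; apply: pV; rewrite inE zp orbT.
- have : y \in V by apply: pV; rewrite !inE eqxx orbT.
  by rewrite inE => /orP[//|/hB]; rewrite yx.
by move: main => /=; arith.
Qed.

Variables (A B : nat -> {set T}) (w q : nat).
Hypothesis s_gt0 : 0 < s.
Hypothesis ws : 4 * s <= w.
Hypothesis cardA : forall i, i < q -> #|A i| = w.
Hypothesis cardB : forall i, i < q -> #|B i| = w.
Hypothesis colA : forall i, i < q -> {in A i, forall x, ~~ c x}.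
Hypothesis colB : forall i, i < q -> {in B i, forall x, c x}.
Hypothesis block : forall i, i < q -> joined e s (A i) (B i).
Hypothesis link : forall i, i.+1 < q ->
  joined e s (A i) (B i.+1) \/ joined e s (B i) (A i.+1).
Hypothesis disj : forall i j, i < j -> j < q -> [disjoint A i :|: B i & A j :|: B j].

Lemma chain_path i : i < q -> exists p t, [/\ sorted e (p ++ t), uniq (p ++ t),
   {subset p ++ t <= \bigcup_(j < i.+1) (A j :|: B j)}, {subset t <= A i :|: B i} &
   [/\ size t = 2 * s, forall x, ohead (p ++ t) = Some x -> x \in A 0 &
       i.+1 * (2 * w - 8 * s) + 4 * s <= size (p ++ t)]].
Proof.
elim: i => [|i IH] iq.
  have [||||||x [p [pp up sp xA szp]]] := @dfs_path (A 0) (B 0) w; rewrite ?cardA ?cardB //.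
  - by arith.
  - exact: colA.
  - exact: colB.
  - exact: block.
  exists (take ((size p).+1 - 2 * s) (x :: p)), (drop ((size p).+1 - 2 * s) (x :: p)).
  rewrite cat_take_drop; split=> //.
  - by move=> z zp; rewrite big_ord_recl big_ord0 setU0; apply: sp.
  - by move=> z /mem_drop /sp.
  split; first by rewrite size_drop /=; arith.
    by move=> z [<-].
  by rewrite /=; arith.
have [p [t [so un sb tb [st hd sz]]]] := IH (ltnW iq).
have [||||||x [r [pr ur sr xA szr]]] := @dfs_path (A i.+1) (B i.+1) w; rewrite ?cardA ?cardB //.
- by arith.
- exact: colA.
- exact: colB.
- exact: block.
set Q := x :: r; set t' := take (2 * s) Q.
have st' : size t' = 2 * s by rewrite size_takel //=; arith.
have sot : sorted e t by case: (cat_sorted2 so).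
have sot' : sorted e t' by apply: take_sorted.
have unt : uniq t by move: un; rewrite cat_uniq => /and3P[].
have unt' : uniq t' by apply: take_uniq.
have card_col (a : pred T) (u : seq T) : uniq u -> s <= count a u ->
   s <= #|[set z in u | a z]|.
  move=> uu su; apply: leq_trans su _; rewrite -size_filter.
  rewrite -(card_uniqP (filter_uniq _ uu)); apply: subset_leq_card.
  by apply/subsetP => z; rewrite !inE mem_filter andbC.
have cnt u : sorted e u -> size u = 2 * s -> s <= count c u /\ s <= count (predC c) u.
  by move=> /count_sorted + su; rewrite su uphalf_half mul2n doubleK; arith.
have tb' z : z \in t' -> z \in A i.+1 :|: B i.+1 by move=> /mem_take/sr.
have [z [z' [zt z't' zz']]] : exists z z', [/\ z \in t, z' \in t' & e z z'].
  have [c1 c2] := cnt _ sot st; have [c3 c4] := cnt _ sot' st'.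
  have inA j y : j < q -> y \in A j :|: B j -> ~~ c y -> y \in A j.
    by move=> jq; rewrite inE => /orP[//|/(colB jq) ->].
  have inB j y : j < q -> y \in A j :|: B j -> c y -> y \in B j.
    by move=> jq; rewrite inE => /orP[/(colA jq)/negbTE ->|//].
  case: (link iq) => jn.
  - have [|||| z [z' [zt z't' zz']]] :=
      jn [set z in t | ~~ c z] [set z in t' | c z].
    + by apply/subsetP => y; rewrite inE => /andP[/tb h1 h2]; apply: inA => //; apply: ltnW.
    + by apply/subsetP => y; rewrite inE => /andP[/tb' h1 h2]; apply: inB.
    + exact: (card_col (predC c) t).
    + exact: (card_col c t').
    by exists z, z'; move: zt z't'; rewrite !inE => /andP[? _] /andP[? _].
  - have [|||| z [z' [zt z't' zz']]] :=
      jn [set z in t | c z] [set z in t' | ~~ c z].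
    + by apply/subsetP => y; rewrite inE => /andP[/tb h1 h2]; apply: inB => //; apply: ltnW.
    + by apply/subsetP => y; rewrite inE => /andP[/tb' h1 h2]; apply: inA.
    + exact: (card_col c t).
    + exact: (card_col (predC c) t').
    by exists z, z'; move: zt z't'; rewrite !inE => /andP[? _] /andP[? _].
have [t1 [t2 et]] : exists t1 t2, t = t1 ++ z :: t2.
  by case/splitPr: zt => t1 t2; exists t1, t2.
have [q1 [q2 [eQ sq1]]] : exists q1 q2, Q = q1 ++ z' :: q2 /\ size q1 < 2 * s.
  move: (cat_take_drop (2 * s) Q) st'; rewrite -/t'.
  case/splitPr: z't' => q1 q2 eQ; rewrite size_cat /= => hs.
  exists q1, (q2 ++ drop (2 * s) Q); split; last by arith.
  by rewrite -{1}eQ -catA.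
have sQ : size Q = (size q1 + size q2).+1 by rewrite eQ size_cat /= addnS.
have sq2 : (size r).+1 = (size q1 + size q2).+1 by rewrite -sQ.
have sq3 : 2 * s <= size q2 by move: sq2 szr sq1 ws s_gt0; move: (size q1) (size q2) (size r); clear; lia.
have sub1 y : y \in p ++ t1 ++ [:: z] -> y \in p ++ t.
  by rewrite et !mem_cat !inE => /or3P[]->; rewrite ?orbT.
have sub2 y : y \in z' :: q2 -> y \in A i.+1 :|: B i.+1.
  by move=> h; apply: sr; rewrite -/Q eQ mem_cat h orbT.
pose k := size q2 - 2 * s.
exists (p ++ t1 ++ z :: z' :: take k q2), (drop k q2).
have -> : (p ++ t1 ++ z :: z' :: take k q2) ++ drop k q2 =
   (p ++ t1) ++ z :: z' :: q2 by rewrite -!catA /= cat_take_drop.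
have e1 : (p ++ t1) ++ z :: z' :: q2 = (p ++ t1 ++ [:: z]) ++ z' :: q2.
  by rewrite -!catA.
split.
- rewrite sorted_cat_cons /= zz' /=; move: so; rewrite et catA sorted_cat_cons.
  case/andP => -> _ /=; have : sorted e Q by exact: pr.
  by rewrite eQ sorted_cat_cons => /andP[].
- rewrite e1 cat_uniq; apply/and3P; split.
  + move: un; rewrite et -cat1s !catA cat_uniq => /and3P[+ _ _].
    by rewrite -!catA.
  + apply/hasPn => y /sub2 yI; apply/negP => /sub1/sb /bigcupP[j _ yj].
    have dj := disj (ltn_ord j) iq.
    by have := disjointFr dj yj; rewrite yI.
  + by move: ur; rewrite -/Q eQ cat_uniq => /and3P[].
- move=> y; rewrite e1 mem_cat big_ord_recr in_setU => /orP[/sub1/sb ->//|/sub2 /= ->].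
  by rewrite orbT.
- by move=> y /mem_drop yq; apply: sub2; rewrite inE yq orbT.
split.
- by rewrite size_drop /k; move: sq3; move: (size q2); clear; lia.
- by move: hd; rewrite et catA; case: (p ++ t1).
move: sz; rewrite et !size_cat /= (mulSn i.+1) => sz.
have : size t1 + (size t2).+1 = 2 * s by rewrite -st et size_cat.
move: sz sq2 szr sq1 ws; move: (i.+1 * _) (size q1) (size q2) (size r) (size p) (size t1) (size t2).
by clear; lia.
Qed.

End LongPaths.

(** * Closing up *)

Section Routes.
Variables (T : finType) (g : rel T) (U : nat -> {set T}).
Hypothesis gs : symmetric g.

(** A return route of exact length [i]. The order in which it meets the sets [U j] is forgotten:
    later uses need its length, its end and the union containing its other vertices. Tuples make the
    existential boolean. *)
Definition routed i v := [exists p : i.-tuple T, [&& path g v p, uniq p,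
  last v p \in U 0 &
  all [pred z | (z == last v p) || (z \in \bigcup_(j < i | 0 < j) U j)] p]].

Lemma routedP i v : reflect (exists p : seq T, [/\ path g v p, uniq p, last v p \in U 0,
  size p = i & forall z, z \in p -> z = last v p \/ z \in \bigcup_(j < i | 0 < j) U j])
  (routed i v).
Proof.
apply: (iffP existsP) => [[p /and4P[? ? ? /allP sub]]|[p [? ? ? /eqP sp sub]]].
  exists p; rewrite size_tuple; split=> // z /sub /orP[/eqP|]; first by left.
  by right.
exists (Tuple sp); apply/and4P; split=> //; apply/allP => z /sub [->|zU].
  by rewrite /= eqxx.
by rewrite /= zU orbT.
Qed.

(** By induction at least [s] of the [2 * s] vertices of [U i] have a route; by [joined_nbs] they
    are seen by all but fewer than [s] vertices of the next set, and each of these prepends one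
    edge. Disjointness of the [U i] keeps the routes simple. *)
Lemma few_unrouted s M (V : nat -> {set T}) : 0 < s ->
  (forall i, i < M -> joined g s (V i) (V i.+1)) ->
  (forall i, i < M -> U i \subset V i) -> (forall i, i < M -> 2 * s <= #|U i|) ->
  (forall i j, i < j -> j < M -> [disjoint U i & U j]) ->
  forall i, 0 < i <= M -> #|[set v in V i | ~~ routed i v]| < s.
Proof.
move=> s0 jn sU cU dU.
pose gd i : {set T} := [set v in U i | if i is 0 then true else routed i v].
have step i : i < M -> s <= #|gd i| -> #|[set v in V i.+1 | ~~ routed i.+1 v]| < s.
  move=> iM gi; have sgV : gd i \subset V i.
    by apply: subset_trans (sU i iM); apply/subsetP => v; rewrite inE => /andP[].
  apply: leq_ltn_trans (joined_nbs (jn i iM) sgV gi); apply: subset_leq_card.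
  apply/subsetP => v; rewrite !inE => /andP[vV]; rewrite vV andbT; apply: contra.
  case/exists_inP => u; rewrite inE => /andP[uU hu]; rewrite gs => vu.
  apply/routedP; case: i iM {gi sgV} vV uU hu => [|i] iM vV uU hu.
    by exists [:: u]; rewrite /= vu; split=> // z; rewrite inE => /eqP ->; left.
  case/routedP: hu => p [pp up lp sp sub]; exists (u :: p); rewrite /= vu up sp andbT.
  have uj j : j < i.+1 -> u \notin U j.
    by move=> ji; apply/negP => /(disjointFr (dU _ _ ji iM)); rewrite uU.
  split=> //.
    apply/negP => /sub [ul|/bigcupP[j _]]; last by rewrite (negbTE (uj j _)).
    by have := uj 0 isT; rewrite ul lp.
  move=> z; rewrite inE => /predU1P[->|/sub [->|/bigcupP[j j0 zj]]]; last 2 first.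
  - by left.
  - by right; apply/bigcupP; exists (widen_ord (leqnSn _) j).
  by right; apply/bigcupP; exists ord_max.
have gd_big i : i < M -> s <= #|gd i|.
  elim: i => [|i IH] iM.
    rewrite (leq_trans (leq_trans _ (cU 0 iM))) //; first by lia.
    by apply: subset_leq_card; apply/subsetP => v vU; rewrite inE vU.
  have := step i (ltnW iM) (IH (ltnW iM)) => h1.
  have h2 := cU i.+1 iM.
  have : #|U i.+1| <= #|gd i.+1| + #|[set v in V i.+1 | ~~ routed i.+1 v]|.
    apply: leq_trans (leq_card_setU _ _).1; apply: subset_leq_card.
    apply/subsetP => v vU; rewrite !inE vU (subsetP (sU _ iM)) //.
    by case: (routed _ _).
  by move: h1 h2; clear; lia.
case=> [|i] // /andP[_ iM]; apply: step => //; exact: gd_big.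
Qed.

End Routes.

Section Closing.
Variables (T : finType) (G : sgraph T).

Lemma close_cycle (W : {set T}) x y p q :
  path G y q -> uniq (y :: q) -> last y q = x -> (forall z, z \in q -> z \in W -> z = x) ->
  path G x p -> uniq (x :: p) -> last x p = y -> {subset x :: p <= W} ->
  3 <= size q + size p -> has_cycle G (size q + size p).
Proof.
move=> pq uq lq intq pp up lp subp sz; split=> //; exists (q ++ p); rewrite size_cat; split=> //.
apply/andP; split; last first.
  have uq' : uniq q by case/andP: uq.
  have [xp up'] : x \notin p /\ uniq p by apply/andP.
  rewrite cat_uniq uq' up' andbT /=.
  apply/hasPn => z zp; apply/negP => zq; move: xp; rewrite -(intq z zq) ?zp //.
  by apply: subp; rewrite inE zp orbT.
by rewrite (cycle_path y) last_cat lq lp cat_path pq lq.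
Qed.

(** The cycle consists of an edge from [W1] to the start of the chain path, an initial segment of
    that path, a return route into [W0] and an exact connection back to [W1]. The flag [tau] tells
    from which side routes of odd length start; the parity of [l] makes the segment end on that
    side. *)
Lemma cycle_through_blocks (c : pred T) (A B : nat -> {set T}) (W0 W1 U : {set T})
    s w q l0 K (tau : bool) l :
  0 < s -> 0 < q -> 4 * s <= w ->
  (forall i, i < q -> #|A i| = w) -> (forall i, i < q -> #|B i| = w) ->
  (forall i, i < q -> {in A i, forall x, ~~ c x}) ->
  (forall i, i < q -> {in B i, forall x, c x}) ->
  (forall i, i < q -> joined G s (A i) (B i)) ->
  (forall i, i.+1 < q -> joined G s (A i) (B i.+1) \/ joined G s (B i) (A i.+1)) ->
  (forall i j, i < j -> j < q -> [disjoint A i :|: B i & A j :|: B j]) ->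
  (forall i, i < q -> [disjoint A i :|: B i & W0 :|: W1 :|: U]) ->
  [disjoint U & W0 :|: W1] -> [disjoint W0 & W1] ->
  (forall x y k, x \in W0 -> y \in W1 -> odd k -> l0 <= k <= l0 + K ->
    exists p, [/\ path G x p, uniq (x :: p), last x p = y, size p = k &
      {subset x :: p <= W0 :|: W1}]) ->
  {in A 0, forall v, exists2 y, y \in W1 & G v y} ->
  (forall i v, i < q -> v \in (if tau then B i else A i) -> exists p,
    [/\ path G v p, uniq p, last v p \in W0, odd (size p) /\ size p < K &
       forall z, z \in p -> z = last v p \/ z \in U]) ->
  odd l0 -> ~~ odd K -> odd l = ~~ tau -> l0 + K <= l -> l <= q * (2 * w - 8 * s) ->
  has_cycle G l.
Proof.
move=> s0 q0 ws cA cB hA hB blk lnk dAB dW dUW dW01 conn start routes ol0 oK ol lmin lmax.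
pose e : rel T := fun u v => G u v && (c u != c v).
have es : symmetric e by move=> u v; rewrite /e adj_sym eq_sym.
have ec u v : e u v -> c u != c v by case/andP.
have eG : subrel e G by move=> u v /andP[].
have je i j : i < q -> j < q -> joined G s (A i) (B j) -> joined e s (A i) (B j).
  move=> iq jq jn X Y sX sY hX hY; have [x [y [xX yY xy]]] := jn X Y sX sY hX hY.
  exists x, y; split=> //; rewrite /e xy (hB j jq y (subsetP sY y yY)).
  by rewrite (negbTE (hA i iq x (subsetP sX x xX))).
have je' i j : i < q -> j < q -> joined G s (B i) (A j) -> joined e s (B i) (A j).
  move=> iq jq /(joined_sym (@adj_sym _ G)) /(je _ _ jq iq); exact: joined_sym.
have [|||p [t [so un sb _ [st hd sz]]]] := @chain_path T e c s es ec A B w q s0 ws cA cB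
   hA hB _ _ dAB q.-1.
- by move=> i iq; apply: je => //; apply: blk.
- by move=> i iq; case: (lnk i iq) => h; [left; apply: je|right; apply: je'] => //; exact: ltnW.
- by rewrite prednK.
rewrite prednK // in sb sz.
move: (p ++ t) so un sb hd sz => [|v P] so un sb hd sz; first by move: sz => /=; lia.
have vA : v \in A 0 by apply: hd.
(* With this length of the initial segment, the first edge and a route of fewer than [K] edges leave
   a remainder [k] in the window from [l0] to [l0 + K], where exact connections exist. *)
set L := l - (l0 + K).
have hL : L <= size P by move: sz lmax => /=; rewrite /L; lia.
set P1 := take L P; set y0 := last v P1.
have pP : path e v P1 by apply: take_path.
have sP1 : size P1 = L by rewrite size_takel.
have uP1 : uniq (v :: P1) by move: (take_uniq L.+1 un).
have subP1 z : z \in v :: P1 -> exists2 i, i < q & z \in A i :|: B i.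
  move=> zP; have /sb/bigcupP[i _ zi] : z \in v :: P.
    by move: zP; rewrite !inE => /predU1P[->|/mem_take ->]; rewrite ?eqxx ?orbT.
  by exists i.
have PW z : z \in v :: P1 -> (z \notin W0 :|: W1) * (z \notin U).
  case/subP1 => i iq zi; have := disjointFr (dW i iq) zi.
  by rewrite in_setU => /norP[-> ->].
have cv : c v = false by apply/negbTE/(hA 0).
have oL : odd L = tau.
  by rewrite /L oddB // oddD ol ol0 (negbTE oK); case: (tau).
have cy0 : c y0 = tau by rewrite /y0 (proper_colour ec pP) cv sP1 oL.
have [i iq y0i] : exists2 i, i < q & y0 \in (if tau then B i else A i).
  have [i iq] := subP1 _ (mem_last v P1); rewrite -/y0 inE => h; exists i => //.
  move: cy0 h; case: (tau) => cy0 /orP[] // h; first by have := hA i iq _ h; rewrite cy0.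
  by have := hB i iq _ h; rewrite cy0.
have [r [pr ur lr [osr sr] inr]] := routes i y0 iq y0i.
have [y1 y1W vy1] := start v vA.
set x := last y0 r in lr inr.
set k := l - (L.+1 + size r).
have hk : L.+1 + size r + k = l by rewrite /k /L; move: sr lmin; clear; lia.
have hk1 : l0 <= k <= l0 + K by move: hk sr lmin; rewrite /L; move: (size r); clear; lia.
have ok : odd k.
  have := congr1 odd hk; rewrite !oddD /= oL osr ol.
  by case: (tau); case: (odd k).
have [p' [pp' up' lp' sp' subp']] := conn x y1 k lr y1W ok hk1.
have eq_l : l = size ((v :: P1) ++ r) + size p' by rewrite size_cat /= sP1 sp' -hk.
have xr : x \in r.
  by move: osr; rewrite /x; case: (r) => //= z r' _; apply: mem_last.
have rW z : z \in r -> z \in W0 :|: W1 -> z = x.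
  by case/inr => // /(disjointFr dUW) ->.
have rP z : z \in r -> z \notin v :: P1.
  move=> /inr zr; apply/negP => zP; have [zW zU] := PW z zP; case: zr => [zx|]; last exact/negP.
  by move: zW; rewrite zx inE lr.
rewrite eq_l; apply: (@close_cycle (W0 :|: W1) x y1) => //.
- by rewrite cat_path /= adj_sym vy1 /= (sub_path eG pP) /= -/y0 pr.
- have y1P : y1 \notin v :: P1.
    by apply/negP => y1P; have := (PW _ y1P).1; rewrite inE y1W orbT.
  have y1r : y1 \notin r.
    apply/negP => y1r; have := rW _ y1r; rewrite inE y1W orbT => /(_ isT) y1x.
    by have := disjointFr dW01 lr; rewrite -y1x y1W.
  have -> : uniq (y1 :: (v :: P1) ++ r) =
    (y1 \notin (v :: P1) ++ r) && uniq ((v :: P1) ++ r) by [].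
  rewrite mem_cat (negbTE y1P) y1r cat_uniq uP1 ur andbT andTb.
  by apply/hasPn.
- by rewrite last_cat /= -/y0.
- move=> z; rewrite mem_cat => /orP[zP|]; last exact: rW.
  by rewrite (negbTE (PW z zP).1).
rewrite -eq_l -hk; move: hk1 ol0 osr; case: (l0) => // n; case: (size r) => // m.
by clear; lia.
Qed.

End Closing.

(** * Cycles in chains of clusters *)

Section Subsets.
Variable T : finType.
Implicit Types A B : {set T}.

Definition trim n A : {set T} := [set x in take n (enum A)].

Lemma trim_sub n A : trim n A \subset A.
Proof. by apply/subsetP => x; rewrite inE => /mem_take; rewrite mem_enum. Qed.

Lemma card_trim n A : n <= #|A| -> #|trim n A| = n.
Proof.
move=> nA; rewrite cardsE (card_uniqP _) ?size_takel -?cardE //.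
by rewrite take_uniq // enum_uniq.
Qed.

Lemma card_setD_ge A B m n : m + n <= #|A| -> #|A :&: B| <= n -> m <= #|A :\: B|.
Proof. by have := cardsID B A; lia. Qed.

End Subsets.

Section Clusters.
Variables (T : finType) (G : sgraph T) (s mm : nat).
Hypothesis s_gt0 : 0 < s.

(** Fewer than [s] vertices of [Vs M] lack a route of length [M] ending in [W0], while [W1] has at
    least [s] vertices. So some vertex of [W1] has a route, which an exact connection closes. *)
Lemma short_cycle (Vs : nat -> {set T}) M D a j l : 0 < M ->
  (forall i k, i < k -> k <= M -> [disjoint Vs i & Vs k]) ->
  (forall i, i <= M -> mm <= #|Vs i|) ->
  (forall i, i < M -> joined G s (Vs i) (Vs i.+1)) -> joined G s (Vs 0) (Vs M) ->
  10 <= D -> 0 < a -> a <= D ^ j -> 2 * s + 5 * a <= 2 * (D.+2 * a) ->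
  D.+2 * (5 * a) + 2 * s + D.+2 * s <= mm ->
  ~~ odd l -> 60 * j + 20 + 10 * l <= a -> has_cycle G (M + (2 * j + 3 + l)).
Proof.
move=> M0 dV cV jV j0M D10 a0 aD hs hmm ol hl.
have d0M : [disjoint Vs 0 & Vs M] by apply: dV.
have hmm0 := leq_trans hmm (cV 0 isT); have hmmM := leq_trans hmm (cV M (leqnn M)).
have [W0 [W1 [s0 s1 c0 c1 con]]] :=
  exact_connection (@adj_sym _ G) d0M j0M D10 a0 aD hs hmm0 hmmM.
have mm4 : 4 * s <= mm.
  by apply: leq_trans hmm; rewrite !mulSn; move: (D * s) (D * (5 * a)); clear; lia.
pose U i := if i is 0 then W0 else Vs i.
have sU i : i < M -> U i \subset Vs i by case: i.
have cW0 : 2 * s <= #|W0|.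
  have := cardsID W0 (Vs 0); rewrite (setIidPr s0); have := cV 0 isT.
  by move: c0 mm4 s_gt0; clear; lia.
have cW1 : s <= #|W1|.
  have := cardsID W1 (Vs M); rewrite (setIidPr s1); have := cV M (leqnn M).
  by move: c1 mm4 s_gt0; clear; lia.
have cU i : i < M -> 2 * s <= #|U i|.
  by case: i => // i iM; apply: leq_trans (cV _ (ltnW iM)); move: mm4; clear; lia.
have dU i k : i < k -> k < M -> [disjoint U i & U k].
  move=> ik kM; have := dV _ _ ik (ltnW kM); apply: disjointW => //; first exact: sU (ltn_trans ik kM).
  exact: sU.
have few : #|[set v in Vs M | ~~ routed G U M v]| < s.
  by apply: (few_unrouted (@adj_sym _ G) s_gt0 jV sU cU dU); rewrite M0 leqnn.
have [y yW1 ry] : exists2 y, y \in W1 & routed G U M y.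
  case: (pickP [pred y in W1 | routed G U M y]) => [y /andP[? ?]|none]; first by exists y.
  have : s <= #|[set v in Vs M | ~~ routed G U M v]|.
    apply: leq_trans cW1 _; apply: subset_leq_card; apply/subsetP => v vW.
    by have := none v; rewrite !inE vW /= (subsetP s1) // => ->.
  by rewrite leqNgt few.
case/routedP: ry => q [pq uq lq sq inq].
have [p [pp up lp sp subp]] := con _ _ l lq yW1 ol hl.
have UW i : 0 < i -> i < M -> [disjoint U i & W0 :|: W1].
  case: i => // i _ iM; apply/disjointP => z zU; rewrite in_setU negb_or; apply/andP; split.
    by apply/negP => /(subsetP s0)/(disjointFr (dV 0 i.+1 isT (ltnW iM))); rewrite zU.
  by apply/negP => /(subsetP s1)/(disjointFl (dV i.+1 M iM (leqnn M))); rewrite zU.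
have y0 : y \notin W0.
  by apply/negP => /(subsetP s0)/(disjointFr d0M); rewrite (subsetP s1).
rewrite -sp -{1}sq; apply: (@close_cycle _ G (W0 :|: W1) (last y q) y) => //.
- rewrite /= uq andbT; apply/negP => /inq[yl|/bigcupP[i i0 yi]].
    by move: lq; rewrite -yl (negbTE y0).
  by have := disjointFr (UW i i0 (ltn_ord i)) yi; rewrite in_setU yW1 orbT.
- move=> z /inq [//|/bigcupP[i i0 zi]].
  by rewrite (disjointFr (UW i i0 (ltn_ord i)) zi).
- by rewrite sp sq; move: M0; clear; lia.
Qed.

(** With branching 11 and about [s / 10] leaves, [exact_connection] asks for sets of about
    [21.5 * s] vertices. The [2 * s] vertices of [relay] are what [few_unrouted] asks for. *)
Definition reserve (Z : {set T}) := trim (22 * s) Z.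
Definition relay (Z : {set T}) := trim (2 * s) (Z :\: reserve Z).

(* [Vs] lists the clusters met by the routes that return to [V 0], in reverse
   order; [rk c] is the position of the cluster [V c] on that list. *)
Lemma reservoirs (V Vs : nat -> {set T}) (rk : nat -> nat) N M D a j K :
  1 < N -> (forall i k, i < k -> k < N -> [disjoint V i & V k]) ->
  (forall i, i < N -> mm <= #|V i|) -> joined G s (V 0) (V 1) -> Vs 0 = V 0 ->
  (forall i, i < M -> joined G s (Vs i) (Vs i.+1)) ->
  (forall i k, i < k -> k < M -> [disjoint Vs i & Vs k]) ->
  (forall i, i < M -> exists2 c, c < N & Vs i = V c) ->
  (forall c, c < N -> 0 < rk c -> V c = Vs (rk c) /\ rk c <= M) ->
  26 * s <= mm -> 10 <= D -> 0 < a -> a <= D ^ j -> 2 * s + 5 * a <= 2 * (D.+2 * a) ->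
  D.+2 * (5 * a) + 2 * s + D.+2 * s <= 22 * s -> 60 * j + 20 + 10 * K <= a ->
  exists (W0 W1 U : {set T}) (X : nat -> {set T}),
  [/\ forall c, c < N -> [/\ X c \subset V c, mm - 26 * s <= #|X c| &
        [disjoint X c & W0 :|: W1 :|: U]],
    [disjoint U & W0 :|: W1], [disjoint W0 & W1],
    (forall x y k, x \in W0 -> y \in W1 -> odd k -> 2 * j + 3 <= k <= 2 * j + 3 + K ->
      exists p, [/\ path G x p, uniq (x :: p), last x p = y, size p = k &
        {subset x :: p <= W0 :|: W1}]) &
    {in X 0, forall v, exists2 y, y \in W1 & G v y} /\
    (forall c v, c < N -> 0 < rk c -> v \in X c -> exists p,
      [/\ path G v p, uniq p, last v p \in W0, size p = rk c &
         forall z, z \in p -> z = last v p \/ z \in U])].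
Proof.
move=> N1 dV cV j01 Vs0 jVs dVs Vs_V rkV mms D10 a0 aD hs hf hK.
have N0 : 0 < N by apply: ltn_trans N1.
have subR Z : reserve Z \subset Z := trim_sub _ _.
have subL Z : relay Z \subset Z := subset_trans (trim_sub _ _) (subsetDl _ _).
have RL Z : [disjoint relay Z & reserve Z].
  by apply/disjointP => x /(subsetP (trim_sub _ _)) /setDP[].
have cR c : c < N -> #|reserve (V c)| = 22 * s.
  by move=> cN; apply: card_trim; apply: leq_trans (cV c cN); move: mms; clear; lia.
have cL c : c < N -> #|relay (V c)| = 2 * s.
  move=> cN; apply: card_trim; apply: (@card_setD_ge _ _ _ _ (22 * s)).
    by apply: leq_trans (cV c cN); move: mms; clear; lia.
  by rewrite -(cR c cN) subset_leq_card // subsetIr.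
have d01 : [disjoint reserve (V 0) & reserve (V 1)].
  by apply: disjointW (dV 0 1 isT N1).
have [||W0 [W1 [s0 s1 c0 c1 con]]] := exact_connection (@adj_sym _ G) d01
   (joinedS (subR _) (subR _) j01) D10 a0 aD hs.
- by rewrite cR.
- by rewrite cR.
pose U' i := if i is 0 then W0 else relay (Vs i).
have sU' i : i < M -> U' i \subset Vs i.
  by case: i => [_|i _]; [rewrite Vs0 (subset_trans s0)|apply: subL].
have cU' i : i < M -> 2 * s <= #|U' i|.
  case: i => [_|i iM]; last by have [c cN /= ->] := Vs_V _ iM; rewrite cL.
  have := cardsID W0 (reserve (V 0)); rewrite (setIidPr s0) cR //.
  by move: c0; rewrite /=; clear; lia.
have dU' i k : i < k -> k < M -> [disjoint U' i & U' k].
  by move=> ik kM; apply: disjointW (dVs _ _ ik kM); apply: sU' => //; apply: ltn_trans kM.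
have few i : 0 < i <= M -> #|[set v in Vs i | ~~ routed G U' i v]| < s.
  exact: (few_unrouted (@adj_sym _ G) s_gt0 jVs sU' cU' dU').
pose U := \bigcup_(i < M | 0 < i) U' i.
pose bad c := [set v in V c | (0 < rk c) && ~~ routed G U' (rk c) v].
(* The four removed sets have at most [22 * s], [2 * s], [s] and [s] elements, in total [26 * s].
   The last one matters in [V 0], where every vertex left must have a neighbour in [W1]. *)
pose X c := V c :\: (reserve (V c) :|: relay (V c) :|: bad c :|: (V 0 :\: nbs G W1)).
have cW1 : s <= #|W1|.
  have := cardsID W1 (reserve (V 1)); rewrite (setIidPr s1) cR //.
  by move: c1; clear; lia.
have cS : #|V 0 :\: nbs G W1| < s.
  exact: joined_nbs (joined_sym (@adj_sym _ G) j01) (subset_trans s1 (subR _)) cW1.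
have cB c : c < N -> #|bad c| <= s.
  move=> cN; rewrite /bad; have [h|h] := ltnP 0 (rk c); last first.
    rewrite (_ : [set v in V c | _] = set0) ?cards0 //.
    by apply/setP => v; rewrite !inE andbF.
  have [Vc rM] := rkV c cN h; apply: ltnW; apply: leq_ltn_trans (few (rk c) _); last by rewrite h.
  by rewrite Vc.
have clusters c d z : c < N -> d < N -> z \in V c -> z \in V d -> c = d.
  move=> cN dN zc zd; case: (ltngtP c d) => // h.
    by have := disjointFr (dV _ _ h dN) zc; rewrite zd.
  by have := disjointFr (dV _ _ h cN) zd; rewrite zc.
have Xsub c : X c \subset V c by apply: subsetDl.
have XU c z : c < N -> z \in X c -> z \notin U.
  move=> cN zX; apply/negP => /bigcupP[[[|i] iM] //= _ zL].
  have [d dN Vd] := Vs_V _ iM; rewrite Vd in zL.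
  have cd : c = d by apply: clusters (subsetP (Xsub c) z zX) (subsetP (subL _) z zL).
  by move: zX; rewrite cd in_setD !in_setU zL !orbT.
have XW c z : c < N -> z \in X c -> z \notin W0 :|: W1.
  move=> cN zX; rewrite in_setU; apply/negP.
  have zV := subsetP (Xsub c) z zX.
  case/orP => [/(subsetP s0)|/(subsetP s1)] zR.
    have c0' : c = 0 by apply: clusters zV (subsetP (subR _) z zR).
    by move: zX; rewrite c0' in_setD !in_setU zR.
  have c1' : c = 1 by apply: clusters zV (subsetP (subR _) z zR).
  by move: zX; rewrite c1' in_setD !in_setU zR.
exists W0, W1, U, X; split.
- move=> c cN; split=> //; last first.
    by apply/disjointP => z zX; rewrite in_setU negb_or (XW c) // (XU c).
  rewrite /X; apply: (@card_setD_ge _ _ _ _ (26 * s)).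
    by rewrite subnK // cV.
  apply: leq_trans (subset_leq_card (subsetIr _ _)) _.
  apply: leq_trans (leq_card_setU _ _).1 _.
  apply: leq_trans (leq_add (leq_card_setU _ _).1 (leqnn _)) _.
  apply: leq_trans (leq_add (leq_add (leq_card_setU _ _).1 (leqnn _)) (leqnn _)) _.
  rewrite cR // cL //; have := cB c cN; move: cS; clear; lia.
- apply/disjointP => z /bigcupP[[[|i] iM] //= _ zL].
  have [d dN Vd] := Vs_V _ iM; rewrite Vd in zL.
  have zd := subsetP (subL _) z zL; have zR := disjointFr (RL _) zL.
  rewrite in_setU; apply/negP; case/orP => [/(subsetP s0)|/(subsetP s1)] zR'.
    have d0 : d = 0 by apply: clusters zd (subsetP (subR _) z zR').
    by move: zR; rewrite d0 zR'.
  have d1 : d = 1 by apply: clusters zd (subsetP (subR _) z zR').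
  by move: zR; rewrite d1 zR'.
- exact: disjointW d01.
- move=> x y k xW yW ok /andP[k1 k2].
  have := con x y (k - (2 * j + 3)) xW yW; rewrite subnKC //; apply.
    by rewrite oddB // ok oddD mul2n odd_double.
  by move: k2 hK; clear; lia.
split.
  move=> v vX; have vV := subsetP (Xsub 0) v vX; move: vX.
  rewrite in_setD !in_setU !negb_or in_setD vV !andbT => /andP[_].
  by rewrite negbK => /nbsP[y yW1 yv]; exists y; rewrite // adj_sym.
move=> c v cN rk0 vX; have vV := subsetP (Xsub c) v vX.
have : v \notin bad c by move: vX; rewrite in_setD !in_setU !negb_or => /andP[/andP[/andP[]]].
rewrite inE vV rk0 /= negbK => /routedP[p [pp up lp sp inp]].
exists p; split=> // z /inp [->|/bigcupP[i i0 zi]]; [by left|right].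
have [_ rM] := rkV c cN rk0; apply/bigcupP; exists (widen_ord rM i) => //.
Qed.

(** The blocks are the pairs [V (2 * i)], [V (2 * i).+1]. Return routes run down the path from the
    second cluster of a pair, so their length [2 * i + 1] is odd. The loss per cluster is [26 * s]
    for the reservoirs and [4 * s] for the chain. *)
Lemma long_even (V : nat -> {set T}) q D a j K l : 0 < q ->
  (forall i k, i < k -> k < 2 * q -> [disjoint V i & V k]) ->
  (forall i, i < 2 * q -> mm <= #|V i|) ->
  (forall i, i.+1 < 2 * q -> joined G s (V i) (V i.+1)) ->
  30 * s <= mm -> 10 <= D -> 0 < a -> a <= D ^ j -> 2 * s + 5 * a <= 2 * (D.+2 * a) ->
  D.+2 * (5 * a) + 2 * s + D.+2 * s <= 22 * s -> 60 * j + 20 + 10 * K <= a ->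
  ~~ odd K -> 2 * q <= K -> ~~ odd l -> 2 * j + 3 + K <= l -> l <= 2 * q * (mm - 30 * s) ->
  has_cycle G l.
Proof.
move=> q0 dV cV jV mms D10 a0 aD hs hf hK oK qK ol l1 l2.
have [|||||||W0 [W1 [U [X [hX dU dW con [start routes]]]]]] :=
  @reservoirs V V id (2 * q) (2 * q).-1 D a j K _ dV cV _ erefl _ _ _ _ _ D10 a0 aD hs hf hK.
- by move: q0; clear; lia.
- by apply: jV; move: q0; clear; lia.
- by move=> i iq; apply: jV; move: iq; clear; lia.
- by move=> i k ik kq; apply: dV => //; move: kq; clear; lia.
- by move=> i iq; exists i => //; move: iq; clear; lia.
- by move=> c cq _; split=> //; move: cq; clear; lia.
- by move: mms; clear; lia.
pose w := mm - 26 * s.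
pose A i := trim w (X (2 * i)); pose B i := trim w (X (2 * i).+1).
have iA i : i < q -> 2 * i < 2 * q by rewrite ltn_mul2l.
have iB i : i < q -> (2 * i).+1 < 2 * q by clear; lia.
have sXV c : c < 2 * q -> trim w (X c) \subset V c.
  by move=> cq; apply: subset_trans (trim_sub _ _) _; have [] := hX c cq.
have cX c : c < 2 * q -> #|trim w (X c)| = w.
  by move=> cq; apply: card_trim; have [] := hX c cq.
have dT c d : c < 2 * q -> d < 2 * q -> c != d -> [disjoint trim w (X c) & trim w (X d)].
  move=> cq dq; rewrite neq_ltn => /orP[h|h].
    by apply: disjointW (dV _ _ h dq); exact: sXV.
  by rewrite disjoint_sym; apply: disjointW (dV _ _ h cq); exact: sXV.
pose c := [pred x | x \in \bigcup_(i < q) B i].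
apply: (@cycle_through_blocks _ G c A B W0 W1 U s w q (2 * j + 3) K true) => //.
- by move: mms; rewrite /w; clear; lia.
- by move=> i iq; apply: cX; apply: iA.
- by move=> i iq; apply: cX; apply: iB.
- move=> i iq x xA; apply/negP => /bigcupP[k _ xB].
  have ne : 2 * i != (2 * k).+1 by apply/eqP; clear; lia.
  by have := disjointFr (dT _ _ (iA i iq) (iB k (ltn_ord k)) ne) xA; rewrite xB.
- by move=> i iq x xB; apply/bigcupP; exists (Ordinal iq).
- by move=> i iq; apply: joinedS (jV _ (iB i iq)); apply: sXV; [exact: iA|exact: iB].
- move=> i iq; right; have e2 : 2 * i.+1 = (2 * i).+2 by clear; lia.
  have h : (2 * i).+2 < 2 * q by rewrite -e2; apply: iA.
  by rewrite /A e2; apply: joinedS (jV _ h); apply: sXV; [exact: ltnW|].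
- move=> i k ik kq; have iq := ltn_trans ik kq.
  apply/disjointP => x; rewrite !in_setU => xi; apply/norP.
  have apart e d : e < 2 * q -> d < 2 * q -> e != d -> x \in trim w (X e) ->
    x \notin trim w (X d) by move=> eq dq ed xe; rewrite (disjointFr (dT _ _ eq dq ed) xe).
  by case/orP: xi => xi; split; apply: apart xi; rewrite ?iA ?iB //;
    apply/eqP; move: ik; clear; lia.
- move=> i iq; apply/disjointP => x; rewrite in_setU => /orP[] /(subsetP (trim_sub _ _)) xX.
    by have [_ _ /disjointFr ->] := hX _ (iA i iq).
  by have [_ _ /disjointFr ->] := hX _ (iB i iq).
- by move=> v /(subsetP (trim_sub _ _)); apply: start.
- move=> i v iq /(subsetP (trim_sub _ _)) vX.
  have [p [pp up lp sp inp]] := routes _ v (iB i iq) isT vX.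
  exists p; rewrite sp /= mul2n odd_double -mul2n; split=> //; split=> //.
  by apply: leq_trans qK; apply: iB.
- by rewrite oddD mul2n odd_double.
- by rewrite (negbTE ol).
by rewrite (leq_trans l2) // /w -mulnA; move: mms q0; clear; nia.
Qed.

(* Each cluster is cut into two halves, so that consecutive clusters of the odd
   cycle share a block of two halves. Block [i] uses the half [false] of [V i]
   and the half [true] of the next cluster [V (up i)]. *)
Lemma long_odd (V : nat -> {set T}) b D a j K l : odd b -> 1 < b ->
  (forall i k, i < k -> k < b -> [disjoint V i & V k]) ->
  (forall i, i < b -> mm <= #|V i|) ->
  (forall i, i.+1 < b -> joined G s (V i) (V i.+1)) -> joined G s (V b.-1) (V 0) ->
  35 * s <= mm -> 10 <= D -> 0 < a -> a <= D ^ j -> 2 * s + 5 * a <= 2 * (D.+2 * a) ->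
  D.+2 * (5 * a) + 2 * s + D.+2 * s <= 22 * s -> 60 * j + 20 + 10 * K <= a ->
  ~~ odd K -> b < K -> odd l -> 2 * j + 3 + K <= l -> l <= b * (mm - 34 * s - 1) ->
  has_cycle G l.
Proof.
move=> ob b1 dV cV jV jb0 mms D10 a0 aD hs hf hK oK bK ol l1 l2.
have b0 : 0 < b by apply: ltnW.
pose up i := if i.+1 == b then 0 else i.+1.
have upb i : i < b -> up i < b.
  by move=> ib; rewrite /up; case: eqP => // /eqP h; rewrite ltn_neqAle h.
have upI i k : i < b -> k < b -> up i = up k -> i = k.
  by rewrite /up; case: eqP; case: eqP; clear; lia.
have jup i : i < b -> joined G s (V i) (V (up i)).
  move=> ib; rewrite /up; case: eqP => [ei|/eqP h]; last by apply: jV; rewrite ltn_neqAle h.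
  by rewrite -ei in jb0.
(* Routes run upwards from [V c] through [V b.-1] to [V 0] and have length [b - c]. From [V 0]
   itself they go once around: [V 0] is also [Vs b]. *)
pose Vs r := if r is 0 then V 0 else V (b - r).
have jr i k : joined G s (V i) (V k) -> joined G s (V k) (V i).
  exact: joined_sym (@adj_sym _ G).
have [||||||W0 [W1 [U [X [hX dU dW con [start routes]]]]]] :=
  @reservoirs V Vs (subn b) b b D a j K b1 dV cV _ erefl _ _ _ _ _ D10 a0 aD hs hf hK.
- exact: jV.
- case=> [|i] ib /=; first by rewrite subn1; apply: jr.
  have -> : b - i.+1 = (b - i.+2).+1 by move: ib; clear; lia.
  by apply/jr/jV; move: ib; clear; lia.
- case=> [|i] [|k] // ik kb /=; first by apply: dV; move: kb; clear; lia.
  by rewrite disjoint_sym; apply: dV; move: ik kb; clear; lia.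
- case=> [|i] ib; first by exists 0.
  by exists (b - i.+1) => //; move: ib; clear; lia.
- move=> c cb _; rewrite leq_subr; split=> //.
  have -> : Vs (b - c) = V (b - (b - c)).
    have : 0 < b - c by rewrite subn_gt0.
    by rewrite /Vs; case: (b - c).
  by rewrite subKn // ltnW.
- by move: mms; clear; lia.
pose w := (mm - 26 * s)./2.
pose Lo c := trim w (X c); pose Hi c := trim w (X c :\: Lo c).
pose P (f : bool) c := if f then Hi c else Lo c.
pose Q i (f : bool) := P f (if f then up i else i).
have ww : 2 * w <= mm - 26 * s by rewrite /w; have := odd_double_half (mm - 26 * s); lia.
have cLo c : c < b -> #|Lo c| = w.
  by move=> cb; apply: card_trim; have [_ h _] := hX c cb; move: ww h; clear; lia.
have cHi c : c < b -> #|Hi c| = w.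
  move=> cb; apply: card_trim; apply: (@card_setD_ge _ _ _ _ w).
    by have [_ h _] := hX c cb; move: ww h; clear; lia.
  by rewrite (leq_trans (subset_leq_card (subsetIr _ _))) // cLo.
have PX f c : P f c \subset X c.
  by case: f; rewrite /P ?trim_sub // (subset_trans (trim_sub _ _)) // subsetDl.
have PV f c : c < b -> P f c \subset V c.
  by move=> cb; apply: subset_trans (PX f c) _; have [] := hX c cb.
have dP f h c d x : c < b -> d < b -> (f, c) <> (h, d) -> x \in P f c -> x \notin P h d.
  move=> cb db ne xc; apply/negP => xd; have xVc := subsetP (PV f c cb) x xc.
  have xVd := subsetP (PV h d db) x xd.
  have cd : c = d.
    case: (ltngtP c d) => // lt.
      by have := disjointFr (dV _ _ lt db) xVc; rewrite xVd.
    by have := disjointFr (dV _ _ lt cb) xVd; rewrite xVc.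
  move: xc xd ne; rewrite -cd /P /Hi; case: (f); case: (h) => // xf xh _.
    by move/(subsetP (trim_sub _ _)): xf; rewrite in_setD xh.
  by move/(subsetP (trim_sub _ _)): xh; rewrite in_setD xf.
have clb i (f : bool) : i < b -> (if f then up i else i) < b by case: f => //; apply: upb.
have dQ i k f h x : i < b -> k < b -> (i, f) <> (k, h) -> x \in Q i f -> x \notin Q k h.
  move=> ib kb ne; apply: dP; [exact: clb|exact: clb|move=> [fh ik]; apply: ne].
  rewrite -fh in ik *; case: (f) ik => [/upI|] ik; by rewrite ik.
(* The alternation puts every [A i] into a cluster of even index [c], also at the wrap-around
   because [b] is odd. Hence its return routes have odd length [b - c], as needed with [tau]
   false. *)
pose A i := Q i (odd i); pose B i := Q i (~~ odd i).
pose c := [pred x | x \in \bigcup_(i < b) B i].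
have cQ i f : i < b -> #|Q i f| = w.
  by move=> ib; rewrite /Q; case: f; rewrite /P ?cLo ?cHi ?upb.
have QV i f : i < b -> Q i f \subset V (if f then up i else i).
  by move=> ib; apply/PV/clb.
apply: (@cycle_through_blocks _ G c A B W0 W1 U s w b (2 * j + 3) K false) => //.
- by rewrite /w; have := odd_double_half (mm - 26 * s); move: mms s_gt0; clear; lia.
- by move=> i ib; apply: cQ.
- by move=> i ib; apply: cQ.
- move=> i ib x xA; apply/negP => /bigcupP[k _]; apply/negP.
  by apply: dQ xA => //; case=> <-; case: (odd i).
- by move=> i ib x xB; apply/bigcupP; exists (Ordinal ib).
- move=> i ib; rewrite /A /B; have q1 := QV i true ib; have q2 := QV i false ib.
  case: (odd i); last exact: joinedS (jup i ib).
  by apply: joinedS (jr _ _ (jup i ib)).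
- move=> i ib; left; rewrite /A /B /= negbK; have ib' := ltnW ib.
  have := QV i (odd i) ib'; have := QV i.+1 (odd i) ib; case: (odd i) => q1 q2.
    have ui : up i = i.+1 by rewrite /up; case: eqP ib => // ->; rewrite ltnn.
    by rewrite ui in q2; apply: joinedS (jup _ ib).
  exact: joinedS (jV i ib).
- move=> i k ik kb; have ib := ltn_trans ik kb.
  have ne f h : (i, f) <> (k, h) by case=> ei; rewrite ei ltnn in ik.
  apply/disjointP => x; rewrite !in_setU => xi; apply/norP.
  by case/orP: xi => xi; split; apply: (dQ i) xi.
- move=> i ib; apply/disjointP => x; rewrite in_setU => /orP[] /(subsetP (PX _ _)) xX.
    by have [_ _ /disjointFr ->] := hX _ (clb i (odd i) ib).
  by have [_ _ /disjointFr ->] := hX _ (clb i (~~ odd i) ib).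
- by move=> v /(subsetP (PX _ _)); apply: start.
- move=> i v ib /(subsetP (PX _ _)); set d := (if odd i then up i else i) => vX.
  have db : d < b by apply: clb.
  have od : odd (b - d).
    rewrite oddB ?(ltnW db) // ob /d; case oi: (odd i); last by rewrite oi.
    by rewrite /up; case: eqP => [ei|_]; rewrite /= ?oi // -ei /= oi in ob *.
  have bd : 0 < b - d by rewrite subn_gt0.
  have [p [pp up' lp sp inp]] := routes d v db bd vX.
  exists p; rewrite sp; split=> //; split=> //.
  by apply: leq_ltn_trans bK; apply: leq_subr.
- by rewrite oddD mul2n odd_double.
apply: leq_trans l2 _; rewrite leq_mul2l; apply/orP; right.
by rewrite /w; have := odd_double_half (mm - 26 * s); case: (odd _); clear; lia.
Qed.

End Clusters.

(** * Numerical sizes of the trees for short and long cycles *)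

Lemma sqr_le_exp2 j : 7 <= j -> j * j <= 2 ^ j.-1.
Proof.
move=> /subnK <-; elim: (j - 7) => [|k IH] //.
rewrite addSn; move: IH; rewrite !addnS /= !expnS; move: (2 ^ _); clear; lia.
Qed.

(** A logarithm [L] above [M + 7] satisfies [L * L <= 2 ^ L.-1], which is below [a]; a smaller one
    is covered by the hypothesis on [a]. This makes tree depths negligible against leaf numbers. *)
Lemma mul_up_log M p a : 1 < p -> 1 < a -> M * (M + 7) <= a -> M * up_log p a <= a.
Proof.
move=> p1 a1 hM; have [h|h] := leqP (up_log p a) (M + 7).
  by apply: leq_trans hM; rewrite leq_mul2l h orbT.
have /andP[hlt _] := up_log_bounds p1 a1.
apply: leq_trans (ltnW hlt); apply: leq_trans (_ : 2 ^ (up_log p a).-1 <= _).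
  apply: leq_trans (sqr_le_exp2 _); last by move: h; clear; lia.
  by rewrite leq_mul2r; move: h; clear; lia.
by rewrite leq_exp2r //; move: h; clear; lia.
Qed.

(* Number of leaves and depth of the two trees used for short cycles, with
   branching [D]; long cycles use branching [11] and [s %/ 10 + 1] leaves. *)
Definition leaves D s := (s %/ D.-1).+1.
Definition depth D s := up_log D (leaves D s).
(** The first summand makes [leaves D s] at least [250 * 250 + 40 * K], and the others make [s / 10]
    large. At these thresholds [mul_up_log] applies with the factors [240] and [80 * D]. *)
Definition s_min D K := D * (250 * 250 + 40 * K) + 10 * (80 * D * (80 * D + 7)) + 10 * (400 + 40 * K).

Section Scales.
Variables (D K s : nat).
Hypothesis D61 : 61 <= D.
Hypothesis s_large : s_min D K <= s.

Let a1 := leaves D s.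
Let j1 := depth D s.
Let a2 := (s %/ 10).+1.
Let j2 := up_log 11 a2.

(** The bounds [120 * j1 + 40 <= a1] and [20 * (2 * j2 + 3 + K) <= a1] make the two regimes overlap:
    a length beyond the short cycles exceeds [a1 / 20], where the long cycles have already begun. *)
Lemma tree_sizes :
  [/\ 10 <= a1, s < a1 * D.-1, a1 * D.-1 <= s + D.-1 & 7 * D <= s] /\
  [/\ 120 * j1 + 40 <= a1, 20 * (2 * j2 + 3 + K) <= a1,
      60 * j2 + 20 + 10 * K <= a2, s < 10 * a2 & 10 * a2 <= s + 10].
Proof.
have h0 := s_large; rewrite /s_min in h0.
have D0 : 0 < D.-1 by move: D61; clear; lia.
have h1 : s < a1 * D.-1 by apply: ltn_ceil.
have h2 : a1 * D.-1 <= s + D.-1.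
  by rewrite /a1 /leaves mulSn addnC leq_add2r leq_trunc_div.
have h3 : s < 10 * a2 by rewrite mulnC; apply: ltn_ceil.
have h4 : 10 * a2 <= s + 10.
  by rewrite /a2 mulnS addnC leq_add2r mulnC leq_trunc_div.
have h5 : s < D * a1.
  by apply: leq_trans h1 _; rewrite mulnC leq_mul2r; move: D61; clear; lia.
have b1 : 250 * 250 + 40 * K <= a1.
  have h : D * (250 * 250 + 40 * K) < D * a1.
    by apply: leq_ltn_trans h5; move: h0; clear; lia.
  by move: h; rewrite ltn_mul2l => /andP[_ /ltnW].
have b2 : 80 * D * (80 * D + 7) + 400 + 40 * K <= a2.
  by move: h0 h3; move: (a2) (80 * D * (80 * D + 7)) (D * (_ + _)); clear; lia.
have l1 : 240 * j1 <= a1.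
  apply: mul_up_log.
  - by move: D61; clear; lia.
  - by apply: leq_trans b1; clear; lia.
  - by apply: leq_trans b1; clear; lia.
have l2 : 80 * D * j2 <= a2.
  apply: mul_up_log => //; first by move: b2; clear; lia.
  by apply: leq_trans b2; rewrite -addnA leq_addr.
have l3 : 80 * j2 <= a1.
  have h : D * (80 * j2) <= D * a1.
    apply: leq_trans (ltnW h5); rewrite mulnCA mulnA; apply: leq_trans l2 _.
    by move: h4 h0 D61; move: (80 * D * (80 * D + 7)); clear; nia.
  by rewrite leq_mul2l in h; case/orP: h => [/eqP h|//]; move: D61; rewrite h.
have l4 : 60 * j2 + 20 + 10 * K <= a2.
  have : 120 * j2 <= a2.
    by apply: leq_trans l2; rewrite leq_mul2r; apply/orP; right; move: D61; clear; lia.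
  by move: b2; move: (80 * D * (80 * D + 7)); clear; lia.
split; split=> //; [move: b1|move: h0|move: b1 l1|move: b1 l3]; clear; nia.
Qed.

Variables (T : finType) (G : sgraph T) (mm : nat).
Hypothesis mm_large : (D + 10) * s <= mm.

Lemma even_cycles (V : nat -> {set T}) q l : 0 < q ->
  (forall i k, i < k -> k < 2 * q -> [disjoint V i & V k]) ->
  (forall i, i < 2 * q -> mm <= #|V i|) ->
  (forall i, i.+1 < 2 * q -> joined G s (V i) (V i.+1)) ->
  ~~ odd K -> 2 * q <= K -> ~~ odd l -> 2 * j1 + 4 <= l -> l <= 2 * q * (mm - 30 * s) ->
  has_cycle G l.
Proof.
have [[a10 la1 ua1 sD] [c1 c2 c3 la2 ua2]] := tree_sizes.
move=> q0 dV cV jV oK qK ol l1 l2.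
have s0 : 0 < s by move: sD D61; clear; lia.
have D1 : 1 < D by move: D61; clear; lia.
have [short|long] := leqP (60 * j1 + 20 + 10 * (l - (2 * j1 + 4))) a1.
  have -> : l = 1 + (2 * j1 + 3 + (l - (2 * j1 + 4))) by move: l1; clear; lia.
  apply: (@short_cycle _ G s mm s0 V 1 D a1 j1) => //.
  - by move=> i k ik k1; apply: dV => //; move: k1 q0; clear; lia.
  - by move=> i i1; apply: cV; move: i1 q0; clear; lia.
  - by case=> // _; apply: jV; move: q0; clear; lia.
  - by apply: jV; move: q0; clear; lia.
  - by move: D61; clear; lia.
  - exact: up_logP.
  - by move: la1 a10 D61; clear; nia.
  (* Since [a1] is about [s / (D - 1)], the summand [D.+2 * (5 * a1)] is close to [5 * s]; [61 <= D]
     and [7 * D <= s] bound it by [6 * s]. *)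
  - apply: leq_trans mm_large; move: ua1 sD D61; clear.
    by move: a1 => a ? ? ?; nia.
  - by rewrite oddB // oddD mul2n odd_double (negbTE ol).
apply: (@long_even _ G s mm s0 V q 11 a2 j2 K) => //.
- by apply: leq_trans mm_large; rewrite leq_mul2r; move: D61; clear; lia.
- exact: up_logP.
- by move: la2; clear; lia.
- by move: ua2 sD D61; clear; lia.
- by move: long c1 c2 l1; clear; lia.
Qed.

(** A short odd cycle uses a route of [b - 1] edges from [V 1] the long way around to [V 0], closed
    by an exact connection between [V 0] and [V 1]. *)
Lemma odd_cycles (V : nat -> {set T}) b l : odd b -> 1 < b ->
  (forall i k, i < k -> k < b -> [disjoint V i & V k]) ->
  (forall i, i < b -> mm <= #|V i|) ->
  (forall i, i.+1 < b -> joined G s (V i) (V i.+1)) -> joined G s (V b.-1) (V 0) ->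
  ~~ odd K -> b < K -> odd l -> 2 * j1 + 3 + b.-1 <= l -> l <= b * (mm - 34 * s - 1) ->
  has_cycle G l.
Proof.
have [[a10 la1 ua1 sD] [c1 c2 c3 la2 ua2]] := tree_sizes.
move=> ob b1 dV cV jV jb0 oK bK ol l1 l2.
have s0 : 0 < s by move: sD D61; clear; lia.
have D1 : 1 < D by move: D61; clear; lia.
have [short|long] := leqP (60 * j1 + 20 + 10 * (l - (2 * j1 + 3 + b.-1))) a1.
  have -> : l = b.-1 + (2 * j1 + 3 + (l - (2 * j1 + 3 + b.-1))) by move: l1; clear; lia.
  pose Vs r := if r is 0 then V 0 else V (b - r).
  have jr i k : joined G s (V i) (V k) -> joined G s (V k) (V i).
    exact: joined_sym (@adj_sym _ G).
  apply: (@short_cycle _ G s mm s0 Vs b.-1 D a1 j1) => //.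
  - by move: b1; clear; lia.
  - case=> [|i] [|k] // ik kb /=; first by apply: dV; move: kb; clear; lia.
    by rewrite disjoint_sym; apply: dV; move: ik kb; clear; lia.
  - by case=> [|i] ib; apply: cV; move: ib b1; clear; lia.
  - case=> [|i] ib /=; first by rewrite subn1; apply: jr.
    have -> : b - i.+1 = (b - i.+2).+1 by move: ib; clear; lia.
    by apply/jr/jV; move: ib; clear; lia.
  - have -> : Vs b.-1 = V 1.
      move: b1; rewrite /Vs; case eb: b.-1 => [|c] b1; first by move: b1 eb; clear; lia.
      by congr V; move: b1 eb; clear; lia.
    exact: jV.
  - by move: D61; clear; lia.
  - exact: up_logP.
  - by move: la1 a10 D61; clear; nia.
  - apply: leq_trans mm_large; move: ua1 sD D61; clear.
    by move: a1 => a ? ? ?; nia.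
  - rewrite oddB // ol 2!oddD oddM /=.
    by move: ob b1; case: (b) => // c /= /negbTE ->.
apply: (@long_odd _ G s mm s0 V b 11 a2 j2 K) => //.
- by apply: leq_trans mm_large; rewrite leq_mul2r; move: D61; clear; lia.
- exact: up_logP.
- by move: la2; clear; lia.
- by move: ua2 sD D61; clear; lia.
- by move: long c1 c2 l1; clear; lia.
Qed.

End Scales.

(** * Choice of the parameters *)

Import Order.TTheory GRing.Theory Num.Theory.

Local Open Scope ring_scope.

Section Constants.
Variables (R : realType) (eps : R).
Hypothesis eps0 : 0 < eps.
Hypothesis eps85 : eps < 1 / 85.

(** With [s] about [eps * m], the requirement [(D + 10) * s <= mm] permits [D] up to about
    [1 / eps - 10]; a further 2 absorbs the rounding of [s] and [mm]. *)
Definition branching := (Num.truncn (1 / eps) - 12)%N.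

Lemma inv_eps_gt85 : 85 < 1 / eps.
Proof. by rewrite ltr_pdivlMr // -ltr_pdivlMl // mulrC. Qed.

Lemma branching_ge : (73 <= branching)%N.
Proof.
have h : (85 <= Num.truncn (1 / eps))%N.
  by rewrite truncn_ge_nat ?ltW ?inv_eps_gt85 // divr_gt0.
by rewrite /branching; lia.
Qed.

Lemma branchingE : branching%:R + 12 = (Num.truncn (1 / eps))%:R :> R.
Proof. by have := branching_ge; rewrite /branching => h; rewrite natrB; [ring|lia]. Qed.

Lemma branching_itv : 1 / eps - 13 < branching%:R <= 1 / eps - 12.
Proof.
have i0 : 0 <= 1 / eps by rewrite divr_ge0 // ltW.
have /andP[] := truncn_itv i0; rewrite -natr1 -branchingE => h1 h2.
by apply/andP; split; lra.
Qed.

(** Exponentiated, this is [(1 / eps) ^ 20 <= D ^ 21]. It holds because [D] exceeds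
    [(1 - 13 * eps) / eps], where [1 - 13 * eps >= 72 / 85], and [(72 / 85) ^ 21] is still at least
    [1 / 85]. The ratio [21 / 20] turns twice the depth into the constant 2.1. *)
Lemma ln_branching : 20 * ln (1 / eps) <= 21 * ln (branching%:R : R).
Proof.
have [h1 _] := andP branching_itv.
have D0 : 0 < branching%:R :> R by rewrite ltr0n; have := branching_ge; lia.
have e0 : 0 < 1 / eps by rewrite divr_gt0.
rewrite !mulr_natl -!lnXn // ler_ln ?posrE ?exprn_gt0 //.
have u72 : 72 / 85 <= 1 - 13 * eps by move: eps85; lra.
pose u : R := 1 - 13 * eps; rewrite -/u in u72.
have eu : 1 / eps - 13 = u / eps by rewrite /u; field; rewrite gt_eqF.
apply: le_trans (_ : (u / eps) ^+ 21 <= _); last first.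
  have u0 : 0 <= u / eps by rewrite -eu; have := inv_eps_gt85; lra.
  by apply: lerXn2r; rewrite ?nnegrE ?(ltW D0) // -eu ltW.
rewrite !expr_div_n !expr1n ler_pdivlMr ?exprn_gt0 //.
have -> : 1 / eps ^+ 20 * eps ^+ 21 = eps by field; rewrite gt_eqF.
apply: le_trans (_ : (72 / 85) ^+ 21 <= _); last first.
  by apply: lerXn2r; rewrite ?nnegrE //; lra.
by apply: le_trans (ltW eps85) _; lra.
Qed.

(** From [D ^ (j - 1) <= n] one gets [2 * j <= 2.1 * ln n / ln (1 / eps) + 2]. The surplus [C - 2.1]
    pays for the remaining constant [k + 5]. *)
Lemma depth_bound (k s n : nat) (C : R) : 21 / 10 < C -> (10 <= s)%N -> (s <= n)%N ->
  (k + 5)%:R <= (C - 21 / 10) / ln (1 / eps) * ln n%:R ->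
  (2 * depth branching s + 3 + k)%:R <= C / ln (1 / eps) * ln n%:R.
Proof.
move=> hC s10 sn hn; set D := branching; set j := depth D s.
have D73 := branching_ge; have lb := ln_branching.
have lD0 : 0 < ln (D%:R : R) by apply: ln_gt0; rewrite ltr1n; rewrite -/D in D73; lia.
have le0 : 0 < ln (1 / eps) by apply: ln_gt0; have := inv_eps_gt85; lra.
have ln0 : 0 <= ln (n%:R : R) by apply: ln_ge0; rewrite ler1n; lia.
have hj : j.-1%:R * ln (D%:R : R) <= ln (n%:R : R).
  have h1 : (D ^ j.-1 <= n)%N.
    have leaf : (leaves D s <= s)%N.
      have h : (s %/ D.-1 <= s %/ 2)%N by apply: leq_div2l; rewrite -/D in D73; lia.
      by rewrite /leaves; have := leq_trunc_div s 2; move: h; lia.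
    have [l1|l1] := leqP (leaves D s) 1.
      have -> : j = 0%N by apply/eqP; rewrite /j /depth up_log_eq0 l1 orbT.
      by rewrite expn0; lia.
    have D1 : (1 < D)%N by rewrite -/D in D73; lia.
    have /andP[h _] := up_log_bounds D1 l1.
    by apply: leq_trans (ltnW h) _; apply: leq_trans sn.
  have Dpos : 0 < D%:R :> R by rewrite ltr0n; apply: leq_trans D73.
  have npos : 0 < n%:R :> R by rewrite ltr0n; lia.
  by rewrite mulr_natl -lnXn // ler_ln ?posrE ?exprn_gt0 // -natrX ler_nat.
have hj' : (2 * j)%:R <= 21 / 10 / ln (1 / eps) * ln (n%:R : R) + 2.
  have h3 : j%:R <= j.-1%:R + 1 :> R by rewrite natr1 ler_nat; lia.
  have h4 : j.-1%:R <= 21 / 20 / ln (1 / eps) * ln (n%:R : R).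
    rewrite mulrAC ler_pdivlMr //.
    apply: le_trans (_ : 21 / 20 * (j.-1%:R * ln (D%:R : R)) <= _); last first.
      by rewrite ler_pM2l //; lra.
    have j0 : 0 <= j.-1%:R :> R by [].
    by rewrite mulrCA ler_wpM2l //; lra.
  rewrite natrM; have -> : 21 / 10 / ln (1 / eps) * ln (n%:R : R) =
    2 * (21 / 20 / ln (1 / eps) * ln (n%:R : R)) by field; rewrite gt_eqF.
  by lra.
have e1 : C / ln (1 / eps) * ln n%:R = (C - 21 / 10) / ln (1 / eps) * ln n%:R +
   21 / 10 / ln (1 / eps) * ln (n%:R : R) by field; rewrite gt_eqF.
rewrite e1 !natrD; move: hn hj'; rewrite natrD; lra.
Qed.

End Constants.

(** * From the eps-graph to chains of clusters *)

Lemma eps_adj_joined (R : realType) (T : finType) (G : sgraph T) (k s : nat)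
    (V : 'I_k -> {set T}) (eps : R) i j :
  eps * (#|T|%:R / k%:R) <= s%:R -> eps_graph G V eps i j -> joined G s (V i) (V j).
Proof.
move=> hs /andP[_ /asboolP[_ _ _ h]] X Y sX sY cX cY.
by apply: h => //; apply: le_trans hs _; rewrite ler_nat.
Qed.

Lemma eps_adj_card (R : realType) (T : finType) (G : sgraph T) (k : nat)
    (V : 'I_k -> {set T}) (eps : R) i j :
  eps_graph G V eps i j -> (Num.truncn (#|T|%:R / k%:R : R) <= #|V i|)%N.
Proof.
move=> /andP[_ /asboolP[_ hV _ _]]; set m := _ / _ in hV *.
have m0 : 0 <= m by rewrite /m divr_ge0.
have /andP[tm _] := truncn_itv m0.
have fl : (Num.truncn m)%:Z <= Num.floor m by rewrite floor_ge_int.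
have : (Num.truncn m)%:Z <= #|V i|%:Z.
  move: hV; rewrite !inE => /orP[]/eqP -> //.
  by rewrite -(ler_int R); apply: le_trans (ceil_ge m).
by [].
Qed.

Lemma eps_adj_card_r (R : realType) (T : finType) (G : sgraph T) (k : nat)
    (V : 'I_k -> {set T}) (eps : R) i j :
  eps_graph G V eps i j -> (Num.truncn (#|T|%:R / k%:R : R) <= #|V j|)%N.
Proof. by rewrite adj_sym; apply: eps_adj_card. Qed.

Lemma balanced_disjoint (T : finType) (k : nat) (V : 'I_k -> {set T}) i j :
  balanced_partition V -> i != j -> [disjoint V i & V j].
Proof.
case=> injV /and3P[_ /trivIsetP tr _] _ ij.
by apply: tr; rewrite ?imset_f //; apply: contra ij => /eqP/injV ->.
Qed.

Theorem lemma4p3 (R : realType) (eps : R) (k : nat) (C1 : R)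
  (heps0 : 0 < eps) (heps1 : eps < 1 / 85)
  (hk : 2 / eps ^+ 2 <= k%:R)
  (hC1 : 21 / 10 < C1) :
  exists N : nat,
    forall (T : finType) (G0 : sgraph T) (V : 'I_k -> {set T}),
      let n := #|T| in
      let S := eps_graph G0 V eps in
      let delta := 48 * eps in
      (N < n)%N ->
      balanced_partition V ->
      (forall b : nat, odd b -> (1 <= b < k)%N -> has_path S b ->
         let a : R := b.+1%:R / k%:R in
         forall l : nat, ~~ odd l ->
           C1 / ln (1 / eps) * ln n%:R <= l%:R <= (1 - delta) * a * n%:R ->
           has_cycle G0 l) /\
      (forall b : nat, odd b -> (3 <= b < k)%N -> has_cycle S b ->
         let a : R := b%:R / k%:R in
         forall l : nat, odd l ->
           (b%:R - 1) * C1 / (2 * ln (1 / eps)) * ln n%:R <= l%:R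
             <= (1 - delta) * a * n%:R ->
           has_cycle G0 l).
Proof.
have gt85 := inv_eps_gt85 heps0 heps1; have D73 := branching_ge heps0 heps1.
have Ditv := branching_itv heps0 heps1.
set D := branching eps in D73 Ditv.
(* The window of exact connections must be even and exceed the length of every return route; this
   value serves all [b < k]. *)
pose K := (2 * k + 2)%N.
have kpos : 0 < k%:R :> R.
  by apply: lt_le_trans hk; rewrite divr_gt0 // exprn_gt0.
have lneps : 0 < ln (1 / eps) by apply: ln_gt0; lra.
pose kap := (C1 - 21 / 10) / ln (1 / eps).
have kap0 : 0 < kap by rewrite /kap divr_gt0 // subr_gt0.
(* Beyond [x1] the surplus [kap * ln n] is at least [k + 5]; beyond [x2] one has
   [eps * m >= s_min D K + 1 / eps]. *)
pose x1 : R := sequences.expR ((k + 5)%:R / kap).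
pose x2 : R := k%:R * (((s_min D K)%:R + 1 / eps) / eps).
exists (Num.truncn (x1 + x2)) => T G V n S delta Nn balV.
have x10 : 0 <= x1 by apply/ltW/expR_gt0.
have x20 : 0 <= x2.
  by rewrite /x2 mulr_ge0 ?ltW // divr_gt0 // ltr_wpDl // divr_gt0.
have nbig : x1 + x2 < n%:R.
  apply: lt_le_trans (truncnS_gt _) _; by rewrite ler_nat.
have n0 : 0 < n%:R :> R by apply: le_lt_trans nbig; rewrite addr_ge0.
have lnn : (k + 5)%:R <= kap * ln n%:R.
  rewrite mulrC -ler_pdivrMr // -(expRK (_ / _)) ler_ln ?posrE ?expR_gt0 //.
  by rewrite -/x1; lra.
pose m : R := n%:R / k%:R.
have em : (s_min D K)%:R + 1 / eps <= eps * m.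
  have h : ((s_min D K)%:R + 1 / eps) / eps <= m.
    by rewrite /m ler_pdivlMr // mulrC -/x2; lra.
  by rewrite -(mulrC m) -ler_pdivrMr.
have m0 : 0 <= m by rewrite /m divr_ge0 // ltW.
pose s := (Num.truncn (eps * m)).+1; pose mm := Num.truncn m.
have em0 : 0 <= eps * m by rewrite mulr_ge0 // ltW.
have s_lo : eps * m <= s%:R by apply/ltW/truncnS_gt.
have s_hi : s%:R <= eps * m + 1.
  by rewrite /s -natr1 lerD2r truncn_le.
have mm_lo : m - 1 <= mm%:R by have := truncnS_gt m; rewrite -natr1 -/mm; lra.
have mm_hi : mm%:R <= m by rewrite truncn_le.
have s_big : (s_min D K <= s)%N.
  by rewrite -(ler_nat R); apply: le_trans s_lo; lra.
have mm_big : ((D + 10) * s <= mm)%N.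
  rewrite -ltnS -(ltr_nat R) -natr1 natrM natrD.
  have h1 : D%:R + 10 <= 1 / eps - 2 by case/andP: Ditv; lra.
  have h2 : (D%:R + 10) * s%:R <= (1 / eps - 2) * (eps * m + 1).
    by apply: ler_pM => //; rewrite addr_ge0.
  have h3 : (1 / eps - 2) * (eps * m + 1) = m - 2 * (eps * m) + 1 / eps - 2.
    by field; rewrite gt_eqF.
  have h4 : 0 <= (s_min D K)%:R :> R by [].
  by apply: le_lt_trans h2 _; rewrite h3; lra.
have D61 : (61 <= D)%N by apply: leq_trans D73.
have s10 : (10 <= s)%N.
  by have [[_ _ _ h] _] := tree_sizes D61 s_big; move: h D73; clear; lia.
have sn : (s <= n)%N.
  apply: leq_trans (_ : mm <= n)%N.
    by apply: leq_trans mm_big; rewrite leq_pmull // addn_gt0 orbT.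
  rewrite -(ler_nat R); apply: le_trans mm_hi _; rewrite /m ler_pdivrMr //.
  by rewrite ler_peMr // ler1n -(ltr0n R).
have deep := depth_bound heps0 heps1 hC1 s10 sn lnn.
rewrite -/D in deep.
(* The allowance per cluster is [48 * eps * m], the loss [34 * s + 1]. The difference of
   [14 * eps * m] covers all rounding, because [eps * m > 85]. *)
have budget : (1 - delta) * m <= (mm - 34 * s - 1)%:R.
  have h : (34 * s + 1 <= mm)%N by move: mm_big s10 D73; clear; nia.
  rewrite -subnDA natrB // natrD natrM /delta.
  have h4 : 0 <= (s_min D K)%:R :> R by [].
  by move: s_hi mm_lo em gt85 h4; lra.
have upper (c l : nat) : l%:R <= (1 - delta) * (c%:R / k%:R) * n%:R ->
    (l <= c * (mm - 34 * s - 1))%N.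
  move=> h; rewrite -(ler_nat R) natrM; apply: le_trans h _.
  have -> : (1 - delta) * (c%:R / k%:R) * n%:R = c%:R * ((1 - delta) * m).
    by rewrite /m; field; rewrite gt_eqF.
  by rewrite ler_wpM2l.
have oK : ~~ odd K by rewrite /K oddD oddM.
split=> b ob /andP[b1 bk].
- case=> x [p [px up sp]] a l ol /andP[l1 l2].
  pose q := b.+1./2; have eq2 : (2 * q = b.+1)%N.
    by rewrite /q mul2n even_halfK //= ob.
  have adjV i : (i.+1 < b.+1)%N -> S (nth x (x :: p) i) (nth x (x :: p) i.+1).
    by rewrite -sp ltnS; move: i; apply/pathP.
  apply: (@even_cycles D K s D61 s_big T G mm mm_big (fun i => V (nth x (x :: p) i)) q) => //.
  + by move: eq2; clear; lia.
  + move=> i j ij jq; apply: balanced_disjoint balV _.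
    rewrite nth_uniq ?ltn_eqF //= sp; move: ij jq; rewrite eq2; clear; lia.
  + move=> i; rewrite eq2 => iq; have [h|h] := ltnP i.+1 b.+1.
      exact: eps_adj_card (adjV i h).
    case: i iq h => [|i] iq h; first by move: h b1; clear; lia.
    exact: eps_adj_card_r (adjV i iq).
  + by move=> i; rewrite eq2 => iq; apply: eps_adj_joined s_lo (adjV i iq).
  + by rewrite eq2 /K; move: bk; clear; lia.
  + have := le_trans deep l1; rewrite ler_nat; move: b1 bk; clear; lia.
  + rewrite eq2; apply: leq_trans (upper b.+1 l l2) _.
    by rewrite leq_mul2l; apply/orP; right; clear; lia.
move: b1 => b3; case=> _ [[|x p] [/andP[cyc uc] sc]] a l ol /andP[l1 l2]; first by rewrite -sc in b3.
have /(pathP x) cycP : path S x (rcons p x) := cyc.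
have sc' : b = (size p).+1 by rewrite -sc.
have adjV i : (i.+1 < b)%N -> S (nth x (x :: p) i) (nth x (x :: p) i.+1).
  move=> ib; have ip : (i < size p)%N by rewrite -ltnS -sc'.
  have := cycP i; rewrite size_rcons => /(_ (ltnW ip)).
  by rewrite -rcons_cons !nth_rcons /= ip ltnS (ltnW ip).
have adj_last : S (nth x (x :: p) b.-1) (nth x (x :: p) 0).
  have := cycP (size p); rewrite size_rcons ltnSn sc' => /(_ isT).
  by rewrite -rcons_cons !nth_rcons /= ltnn eqxx ltnSn.
have bK : (b < K)%N by rewrite /K; move: bk; clear; lia.
apply: (@odd_cycles D K s D61 s_big T G mm mm_big (fun i => V (nth x (x :: p) i)) b) => //.
- by apply: leq_trans b3.
- move=> i j ij jb; apply: balanced_disjoint balV _.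
  by rewrite nth_uniq ?ltn_eqF // sc // (ltn_trans ij).
- move=> i ib; have [h|h] := ltnP i.+1 b; first exact: eps_adj_card (adjV i h).
  have -> : i = b.-1 by move: ib h; clear; lia.
  exact: eps_adj_card adj_last.
- by move=> i ib; apply: eps_adj_joined s_lo (adjV i ib).
- exact: eps_adj_joined s_lo adj_last.
(* As [b >= 3], the factor [(b - 1) / 2] is at least 1, so the smaller bound without it already
   suffices; the [b - 1] edges of the route are covered by the [k] in [deep]. *)
- have h : C1 / ln (1 / eps) * ln n%:R <= l%:R.
    apply: le_trans l1; have -> : (b%:R - 1) * C1 / (2 * ln (1 / eps)) * ln n%:R =
      (b%:R - 1) / 2 * (C1 / ln (1 / eps) * ln n%:R) by field; rewrite gt_eqF.
    have b3R : 3 <= b%:R :> R by rewrite (ler_nat R 3).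
    have pos : 0 <= C1 / ln (1 / eps) * ln n%:R by apply: le_trans deep.
    by rewrite ler_peMl // ler_pdivlMr //; lra.
  have := le_trans deep h; rewrite ler_nat; move: bk; clear; lia.
- exact: upper.
Qed.
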